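(* All of the following tuples are universal: $(16,8,6,4,4,0)$, $(16,8,6,4,6,2)$, $(18,6,6,4,6,2)$, $(20,10,5,1,4,2)$, $(20,10,5,3,4,2)$, $(24,12,6,2,2,0)$.
   Context: For $a_1,b_1,c_1$ positive integers and $a_2,b_2,c_2$ integers with $a_1-a_2$, $b_1-b_2$, $c_1-c_2$ all even, the tuple $(a_1,a_2,b_1,b_2,c_1,c_2)$ is called universal if every nonnegative integer $n$ can be written as $\frac{x(a_1x+a_2)}2+\frac{y(b_1y+b_2)}2+\frac{z(c_1z+c_2)}2$ with $x,y,z\in\mathbb{Z}$. *)

(* Defs.v *)
From mathcomp Require Import all_boot all_order all_algebra.

Set Implicit Arguments.
Unset Strict Implicit.
Unset Printing Implicit Defensive.

Import Order.TTheory GRing.Theory Num.Theory.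
Local Open Scope ring_scope.

(* x (a1 x + a2) / 2, with the division taken in the rationals. *)
Definition half_quad (a1 a2 x : int) : rat := (x * (a1 * x + a2))%:~R / 2%:R.

(* The first two conjuncts are the standing conditions under which the tuple
   (a1, a2, b1, b2, c1, c2) may be called universal. *)
Definition universal (a1 a2 b1 b2 c1 c2 : int) : Prop :=
  [/\ [/\ 0 < a1, 0 < b1 & 0 < c1],
      [/\ (2 %| a1 - a2)%Z, (2 %| b1 - b2)%Z & (2 %| c1 - c2)%Z] &
      forall n : nat, exists x y z : int,
        n%:R = half_quad a1 a2 x + half_quad b1 b2 y + half_quad c1 c2 z].

(* Main.v *)
Require Import Defs.
From mathcomp Require Import all_boot all_order all_algebra all_field.
From mathcomp Require Import realalg zify ring lra.

(** Completing squares turns each tuple into a representation problem for one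
    of the ternary forms x^2+y^2+3z^2 (every n prime to 3, and every 3n with
    n = 10 mod 12) and x^2+y^2+5z^2 (every n = 7 mod 8 with n = +-1 mod 5);
    in the tuple (18,6,6,4,6,2) a rotation of x^2+3z^2 additionally makes z
    prime to 6.
    To represent a number M by diag(1,1,D), one looks for a positive definite
    integral form of determinant D with Gram matrix [a b t; b c 0; t 0 M].
    Such a form exists once c > 0 is squarefree, has prescribed Legendre symbols
    at the primes dividing M, and has only prime factors q modulo which a fixed
    multiple of -M is a square.  Reduction theory leaves two classes of
    determinant D, told apart by the 2x2 minors modulo D.
    The usual construction of c takes a prime in an arithmetic progression.
    Since only quadratic characters matter, Dirichlet's theorem can be avoided:
    for a real character chi put r(m) = sum_(d | m) chi(d).  By the hyperbola
    method sum_(m <= X) r(m) psi(m) / sqrt m stays bounded unless psi is trivial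
    or equal to chi, while r(k^2) >= 1 makes it grow like log X when psi is
    trivial.  Hence some m with r(m) > 0 has any prescribed system of quadratic
    characters compatible with chi(m) = 1, and c is its squarefree part. *)

Set Implicit Arguments.
Unset Strict Implicit.
Unset Printing Implicit Defensive.

Import Order.TTheory GRing.Theory Num.Theory.
Local Open Scope ring_scope.

(** * Legendre symbols and quadratic reciprocity *)

(* Defined by Euler's criterion; the junk value -1 is never reached for an odd
   prime p except at non-residues. *)
Definition legendre (p : nat) (a : int) : int :=
  let x := (a%:~R : 'F_p) ^+ p.-1./2 in
  if x == 1 then 1 else if x == 0 then 0 else -1.

Lemma intFp_eq0 (p : nat) (a : int) : prime p ->
  ((a%:~R : 'F_p) == 0) = (p %| a)%Z.
Proof.
move=> pp; rewrite -(dvdz_pcharf (pchar_Fp pp)) //.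
Qed.

Lemma intFp_eq (p : nat) (a b : int) : prime p ->
  ((a%:~R : 'F_p) == b%:~R) = (p %| a - b)%Z.
Proof. by move=> pp; rewrite -subr_eq0 -rmorphB /= intFp_eq0. Qed.

Lemma odd_half_pred (p : nat) : odd p -> p = (p.-1./2).*2.+1.
Proof. by case: p => // p /= /negbTE op; rewrite -[in LHS](odd_double_half p) op. Qed.

Lemma odd_prime_ndvd2 (p : nat) : prime p -> odd p -> (p %| 2)%N = false.
Proof. by move=> pp op; rewrite dvdn_prime2 //; apply/eqP => e; rewrite e in op. Qed.

Lemma Fp_half_power (p : nat) (x : 'F_p) : prime p -> odd p -> x != 0 ->
  x ^+ p.-1./2 = 1 \/ x ^+ p.-1./2 = -1.
Proof.
move=> pp op x0.
have e : (p.-1./2 * 2 = p.-1)%N by rewrite [in RHS](odd_half_pred op) muln2.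
have : (x ^+ p.-1./2) ^+ 2 = 1.
  rewrite -exprM e; have := expf_card x; rewrite card_Fp // => xp.
  apply: (mulIf x0); rewrite mul1r -exprSr prednK ?prime_gt0 //.
by move/eqP; rewrite sqrf_eq1 => /orP[] /eqP; [left|right].
Qed.

Lemma legE (p : nat) (a : int) : prime p -> odd p ->
  (legendre p a)%:~R = (a%:~R : 'F_p) ^+ p.-1./2.
Proof.
move=> pp op; rewrite /legendre; case: eqP => [->//|n1]; case: eqP => [->//|n0].
rewrite rmorphN1; case: (@Fp_half_power p (a%:~R) pp op) => [|//|->//].
apply/eqP => a0; apply: n0; rewrite a0 expr0n.
by have := prime_gt1 pp; case: (p) op => [|[|[|]]].
Qed.

Definition sgn3 (s : int) := [\/ s = 1, s = 0 | s = -1].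

Lemma leg_sgn3 p a : sgn3 (legendre p a).
Proof. by rewrite /legendre; case: eqP; [|case: eqP]; constructor. Qed.

Lemma sgn3_inj (p : nat) s t : prime p -> odd p -> sgn3 s -> sgn3 t ->
  s%:~R = t%:~R :> 'F_p -> s = t.
Proof.
move=> pp op hs ht /eqP; rewrite intFp_eq // => d.
have p2 := prime_gt1 pp.
case: hs d => ->; case: ht => -> //; rewrite dvdzE /= ?(odd_prime_ndvd2 pp op) //;
  by rewrite dvdn1 => /eqP p1; rewrite p1 in p2.
Qed.

Lemma sgn3M s t : sgn3 s -> sgn3 t -> sgn3 (s * t).
Proof.
by case=> ->; case=> ->; [constructor 1|constructor 2|constructor 3|
 constructor 2| constructor 2|constructor 2|constructor 3|constructor 2|constructor 1].
Qed.

Lemma legM p a b : prime p -> odd p -> legendre p (a * b) = legendre p a * legendre p b.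
Proof.
move=> pp op; apply: (sgn3_inj pp op (leg_sgn3 _ _)); first by apply: sgn3M; apply: leg_sgn3.
by rewrite rmorphM /= !legE // rmorphM exprMn.
Qed.

Lemma leg_mod (p : nat) a b : prime p -> (p %| a - b)%Z -> legendre p a = legendre p b.
Proof. by move=> pp; rewrite -intFp_eq // /legendre => /eqP ->. Qed.

Lemma leg1 p : legendre p 1 = 1.
Proof. by rewrite /legendre expr1n eqxx. Qed.

Lemma leg_eq0 (p : nat) a : prime p -> odd p -> (legendre p a == 0) = (p %| a)%Z.
Proof.
move=> pp op; rewrite -intFp_eq0 //.
have h0 : (0 < p.-1./2)%N by have := prime_gt1 pp; case: (p) op => [|[|[|]]].
apply/eqP/eqP => [e|e].
  have := legE a pp op; rewrite e => /esym/eqP; rewrite expf_eq0 => /andP[_ /eqP //].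
apply: (sgn3_inj pp op (leg_sgn3 _ _)); first by constructor 2.
by rewrite legE // e expr0n; case: (p.-1./2) h0.
Qed.

Lemma leg_pm1 (p : nat) a : prime p -> odd p -> ~~ (p %| a)%Z ->
  legendre p a = 1 \/ legendre p a = -1.
Proof.
by move=> pp op; rewrite -leg_eq0 //; case: (leg_sgn3 p a) => ->; [left|rewrite eqxx|right].
Qed.

Lemma leg_sqr (p : nat) a : prime p -> odd p -> ~~ (p %| a)%Z -> legendre p (a * a) = 1.
Proof.
by move=> pp op pa; rewrite legM //; case: (leg_pm1 pp op pa) => ->.
Qed.

(** A polynomial of degree (p-1)/2 has at most that many roots. Applied to X^((p-1)/2) - 1, this
    yields both a non-residue and the square roots of residues. *)
Lemma Fp_half_roots (p : nat) (s : seq 'F_p) : prime p -> odd p ->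
  uniq s -> all (fun x => x ^+ p.-1./2 == 1) s -> (size s <= p.-1./2)%N.
Proof.
move=> pp op us /allP as1.
have h0 : (0 < p.-1./2)%N by have := prime_gt1 pp; case: (p) op => [|[|[|]]].
have sz : size ('X^(p.-1./2) - 1%:P : {poly 'F_p}) = (p.-1./2).+1.
  by rewrite size_XnsubC.
rewrite -ltnS -sz; apply: max_poly_roots => //.
  by rewrite -size_poly_gt0 sz.
by apply/allP => x /as1; rewrite /root hornerD hornerXn hornerN hornerC subr_eq0.
Qed.

Lemma natFp_eq (p m n : nat) : prime p -> ((m%:R : 'F_p) == n%:R) = (m == n %[mod p]).
Proof.
move=> pp; have := intFp_eq m%:Z n%:Z pp; by rewrite -!pmulrn -eqz_mod_dvd !modz_nat eqz_nat.
Qed.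

Lemma ndvdz_small (p k : nat) : (0 < k < p)%N -> ~~ (p %| k%:Z)%Z.
Proof. by case/andP => k0 kp; rewrite dvdzE /= gtnNdvd. Qed.

Lemma leg_nonres (p : nat) : prime p -> odd p -> exists a : nat, legendre p a = -1.
Proof.
move=> pp op; have p2 := prime_gt1 pp; have hp := odd_half_pred op.
case: (boolP [exists a : 'I_p, legendre p a == -1]) => [/existsP[a /eqP ?]|]; first by exists a.
rewrite negb_exists => /forallP nh.
have := @Fp_half_roots p [seq (k%:R : 'F_p) | k <- iota 1 p.-1] pp op.
rewrite size_map size_iota => H; suff: (p.-1 <= p.-1./2)%N by have := odd_half_pred op; lia.
apply: H.
  rewrite map_inj_in_uniq ?iota_uniq // => x y; rewrite !mem_iota => hx hy /eqP.
  rewrite natFp_eq // !modn_small; [by move/eqP|lia|lia].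
apply/allP => x /mapP[k]; rewrite mem_iota => hk ->.
have kp : (k < p)%N by lia.
have := nh (Ordinal kp) => /=.
case: (@leg_pm1 p k pp op); [by apply: ndvdz_small; lia| |by move=> ->].
by move=> l _; have := legE k pp op; rewrite l -pmulrn => <-.
Qed.

Lemma leg1_sq (p : nat) a : prime p -> odd p -> legendre p a = 1 ->
  exists x : int, (p %| x ^+ 2 - a)%Z.
Proof.
move=> pp op l1; have p2 := prime_gt1 pp; have hp := odd_half_pred op.
case: (boolP [exists x : 'I_p, (x%:R : 'F_p) ^+ 2 == a%:~R]) => [/existsP[x]|].
  move=> e; exists x%:Z; rewrite -intFp_eq // rmorphXn /= -pmulrn //.
rewrite negb_exists => /forallP nh.
(* A non-square [a] of symbol 1 would be one root more than the (p-1)/2 distinct squares already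
   provide. *)
have := @Fp_half_roots p (a%:~R :: [seq (k%:R : 'F_p) ^+2 | k <- iota 1 p.-1./2]) pp op.
rewrite /= size_map size_iota => H; suff: (p.-1./2 < p.-1./2)%N by rewrite ltnn.
apply: H; last first.
  apply/andP; split; first by rewrite -legE // l1.
  apply/allP => x /mapP[k]; rewrite mem_iota => hk ->.
  have := @leg_sqr p k pp op; rewrite -exprM => l.
  have := legE (k%:Z * k%:Z) pp op; rewrite l; last by apply: ndvdz_small; lia.
  by rewrite rmorphM /= -!pmulrn -expr2 -exprM => <-.
apply/andP; split.
  apply/negP => /mapP[k]; rewrite mem_iota => hk e.
  have kp : (k < p)%N by lia.
  by have := nh (Ordinal kp); rewrite /= e eqxx.
rewrite map_inj_in_uniq ?iota_uniq // => x y; rewrite !mem_iota => hx hy /eqP.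
rewrite -subr_eq0 subr_sqr mulf_eq0 subr_eq0 -natrD natFp_eq // => /orP[|].
  by rewrite !modn_small; [move/eqP|lia|lia].
rewrite -[0](mulr0n 1) natFp_eq // mod0n modn_small; lia.
Qed.

Lemma leg_N1 p : prime p -> odd p -> legendre p (-1) = (-1) ^+ p.-1./2.
Proof.
move=> pp op; apply: (sgn3_inj pp op (leg_sgn3 _ _)).
  by rewrite -signr_odd; case: (odd _); [constructor 3|constructor 1].
by rewrite legE // rmorphXn rmorphN1.
Qed.

(** * Gauss's lemma and reciprocity *)

Definition least_res (p a k : nat) : nat :=
  if (p.-1./2 < (a * k) %% p)%N then (p - (a * k) %% p)%N else ((a * k) %% p)%N.

(** Least residues of a x and a y agree only if p divides a (x + y) or a (x - y), impossible for
    distinct x, y in 1..(p-1)/2. An injective self-map of a finite set is a permutation. *)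
Lemma perm_least_res (p a : nat) : prime p -> odd p -> ~~ (p %| a)%N ->
  perm_eq [seq least_res p a k | k <- iota 1 p.-1./2] (iota 1 p.-1./2).
Proof.
move=> pp op pa; have p2 := prime_gt1 pp; have hp := odd_half_pred op.
have nz k : (0 < k < p)%N -> (0 < (a * k) %% p)%N.
  move=> hk; rewrite lt0n -/(dvdn p (a * k)) Euclid_dvdM // negb_or pa /=.
  by have := ndvdz_small hk; rewrite dvdzE.
have lt k : ((a * k) %% p < p)%N by rewrite ltn_mod; lia.
have inj : {in iota 1 p.-1./2 &, injective (least_res p a)}.
  move=> x y; rewrite !mem_iota => hx hy e.
  have : (p %| a * (x + y))%N || (a * x == a * y %[mod p]).
    move: e; rewrite /least_res; have := lt x; have := lt y.
    have hm : (p %| (a * x) %% p + (a * y) %% p)%N -> (p %| a * (x + y))%N.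
      by rewrite /dvdn modnDml modnDmr mulnDr.
    case: ifP => ? ; case: ifP => ? ? ? e.
    - by apply/orP; right; apply/eqP; lia.
    - apply/orP; left; apply: hm.
      by have -> : ((a * x) %% p + (a * y) %% p = p)%N by lia.
    - apply/orP; left; apply: hm.
      by have -> : ((a * x) %% p + (a * y) %% p = p)%N by lia.
    - by apply/orP; right; apply/eqP; lia.
  rewrite -(natFp_eq _ _ pp) !natrM Euclid_dvdM // (negbTE pa) /=.
  case/orP => [d|]; first by have := @ndvdz_small p (x + y) ltac:(lia); rewrite dvdzE /= d.
  have a0 : (a%:R : 'F_p) != 0.
    by rewrite -[0](mulr0n 1) natFp_eq // mod0n.
  move=> /eqP /(mulfI a0) /eqP; rewrite natFp_eq // !modn_small; [by move/eqP|lia|lia].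
have us : uniq [seq least_res p a k | k <- iota 1 p.-1./2].
  by rewrite map_inj_in_uniq ?iota_uniq.
apply: uniq_perm => //; first exact: iota_uniq.
have [//||] := @uniq_min_size _ _ (iota 1 p.-1./2) us; last by [].
  move=> _ /mapP[k hk ->]; move: hk; rewrite !mem_iota /least_res => hk.
  have := nz k ltac:(lia); have := lt k; case: ifP; lia.
by rewrite size_map.
Qed.

Definition gauss_mu (p a : nat) : nat :=
  \sum_(k <- iota 1 p.-1./2) (p.-1./2 < (a * k) %% p)%N.

(** Multiply the congruences a k = +- [least_res p a k] over k and cancel the product of the k,
    which the permutation leaves unchanged. *)
Lemma gauss_lemma (p a : nat) : prime p -> odd p -> ~~ (p %| a)%N ->
  legendre p a = (-1) ^+ gauss_mu p a.
Proof.
move=> pp op pa; have p2 := prime_gt1 pp; have hp := odd_half_pred op.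
apply: (sgn3_inj pp op (leg_sgn3 _ _)).
  by rewrite -signr_odd; case: (odd _); [constructor 3|constructor 1].
rewrite legE // rmorphXn rmorphN1 -pmulrn.
have step k : ((a * k)%:R : 'F_p) =
    (-1) ^+ (p.-1./2 < (a * k) %% p)%N * (least_res p a k)%:R.
  have /eqP -> : ((a * k)%:R == ((a * k) %% p)%:R :> 'F_p).
    by rewrite natFp_eq // modn_mod.
  rewrite /least_res; case: ifP => _; rewrite ?expr0 ?expr1 ?mul1r //.
  rewrite natrB; last by apply: ltnW; rewrite ltn_mod; lia.
  have /eqP -> : (p%:R == 0%:R :> 'F_p) by rewrite natFp_eq // modnn mod0n.
  by rewrite mulr0n sub0r mulN1r opprK.
have : \prod_(k <- iota 1 p.-1./2) ((a * k)%:R : 'F_p) =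
   (-1) ^+ gauss_mu p a * \prod_(k <- iota 1 p.-1./2) (k%:R : 'F_p).
  rewrite (eq_bigr _ (fun k _ => step k)) big_split /= -prodrXr; congr (_ * _).
  by rewrite -[RHS](perm_big _ (perm_least_res pp op pa)) /= big_map.
have -> : \prod_(k <- iota 1 p.-1./2) ((a * k)%:R : 'F_p) =
   a%:R ^+ p.-1./2 * \prod_(k <- iota 1 p.-1./2) (k%:R : 'F_p).
  under eq_bigr do rewrite natrM.
  by rewrite big_split /= big_const_seq count_predT size_iota iter_mulr_1.
apply: mulIf; rewrite prodf_seq_neq0; apply/allP => k; rewrite mem_iota => hk.
by rewrite -[0](mulr0n 1) natFp_eq // mod0n modn_small; lia.
Qed.

(** Eisenstein's step: reduce a k = p floor(a k / p) + (a k mod p) modulo 2 and sum over k; the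
    least residues add up to [S]. *)
Lemma gauss_mu_odd (p a : nat) : prime p -> odd p -> ~~ (p %| a)%N ->
  let S := (\sum_(k <- iota 1 p.-1./2) k)%N in
  odd (gauss_mu p a) =
    odd (a * S) (+) odd S (+) odd (\sum_(k <- iota 1 p.-1./2) (a * k) %/ p)%N.
Proof.
move=> pp op pa S; have p2 := prime_gt1 pp.
have lt k : ((a * k) %% p < p)%N by rewrite ltn_mod; lia.
have step k : odd (a * k) = odd ((a * k) %/ p) (+) odd (least_res p a k) (+)
   (p.-1./2 < (a * k) %% p)%N.
  rewrite {1}(divn_eq (a * k) p) oddD oddM op andbT -addbA; congr (_ (+) _).
  rewrite /least_res; case: ifP => _; last by rewrite addbF.
  by rewrite oddB ?op 1?ltnW ?lt //=; case: (odd _).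
have oddS (F : nat -> nat) s :
    odd (\sum_(k <- s) F k)%N = \big[addb/false]_(k <- s) odd (F k).
  by elim/big_rec2: _ => // k b m _ <-; rewrite oddD.
have -> : odd (a * S) = odd (\sum_(k <- iota 1 p.-1./2) (a * k) %/ p)%N (+) odd S
    (+) odd (gauss_mu p a).
  rewrite /S big_distrr /= -[X in _ (+) odd X (+) _](perm_big _ (perm_least_res pp op pa)).
  rewrite big_map !oddS -!big_split /=.
  by apply: eq_bigr => k _; rewrite step oddb.
by case: (odd _); case: (odd _); case: (odd _).
Qed.

(** The quotients 2k/p vanish for k <= (p-1)/2, which leaves the parity of the triangular number 1 +
    ... + (p-1)/2. It depends on (p-1)/2 modulo 4, that is, on p modulo 8. *)
Lemma leg_2 p : prime p -> odd p ->
  legendre p 2 = if (p %% 8 == 1)%N || (p %% 8 == 7)%N then 1 else -1.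
Proof.
move=> pp op; have p2 := prime_gt1 pp; have hp := odd_half_pred op.
rewrite gauss_lemma ?odd_prime_ndvd2 //.
rewrite -signr_odd gauss_mu_odd ?odd_prime_ndvd2 //.
rewrite [X in _ (+) odd X]big1_seq; last first.
  move=> k; rewrite mem_iota => /= hk; rewrite divn_small //; lia.
rewrite oddM /= addbF.
have -> : (\sum_(k <- iota 1 p.-1./2) k = 'C((p.-1./2).+1, 2))%N.
  by rewrite -bin2_sum big_ltn // add0n /index_iota subn1.
rewrite bin2 /=; move: (p.-1./2) hp => h ->.
rewrite (divn_eq h 4); have := @ltn_pmod h 4 isT; move: (h %/ 4)%N (h %% 4)%N => j.
have e r n : (r + 2 * j * n)./2 = (r./2 + j * n)%N.
  by rewrite halfD -mulnA mul2n odd_double andbF add0n doubleK.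
have m8 r : ((j * 4 + r).*2.+1 %% 8 = r.*2.+1 %% 8)%N.
  by rewrite (_ : _.+1 = j * 8 + r.*2.+1)%N ?modnMDl //; lia.
move=> [|[|[|[|//]]]] _; rewrite m8 /=.
- by have -> : ((j * 4 + 0).+1 * (j * 4 + 0) = 0 + 2 * j * (2 * (j * 4 + 1)))%N;
  [lia|rewrite e oddD !oddM /= ?andbF].
- by have -> : ((j * 4 + 1).+1 * (j * 4 + 1) = 2 + 2 * j * (2 * (4 * j + 3)))%N;
  [lia|rewrite e oddD !oddM /= ?andbF].
- by have -> : ((j * 4 + 2).+1 * (j * 4 + 2) = 6 + 2 * j * (2 * (4 * j + 5)))%N;
  [lia|rewrite e oddD !oddM /= ?andbF].
- by have -> : ((j * 4 + 3).+1 * (j * 4 + 3) = 12 + 2 * j * (2 * (4 * j + 7)))%N;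
  [lia|rewrite e oddD !oddM /= ?andbF].
Qed.

Lemma sum_iota_leq n F : (\sum_(l <- iota 1 n) (l <= F) = minn n F)%N.
Proof.
elim: n => [|n IH]; first by rewrite big_nil min0n.
by rewrite -[n.+1]addn1 iotaD big_cat big_seq1 /= IH; lia.
Qed.

(** Eisenstein's count: the two floor sums count the lattice points of a (p-1)/2 by (q-1)/2
    rectangle on either side of the line p l = q k, which meets none of them. *)
Lemma quad_recip (p q : nat) : prime p -> odd p -> prime q -> odd q -> p != q ->
  legendre p q * legendre q p = (-1) ^+ (p.-1./2 * q.-1./2).
Proof.
move=> pp op pq oq pnq.
have p2 := prime_gt1 pp; have hp := odd_half_pred op.
have q2 := prime_gt1 pq; have hq := odd_half_pred oq.
rewrite !gauss_lemma ?dvdn_prime2 //; last by rewrite eq_sym.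
rewrite -exprD -[LHS]signr_odd oddD !gauss_mu_odd ?dvdn_prime2 //; last by rewrite eq_sym.
rewrite !oddM op oq /= !addbb !addFb -oddD.
rewrite -[RHS]signr_odd; congr (_ ^+ (odd _)).
have fl (p' q' : nat) : prime p' -> p' = p'.-1./2.*2.+1 -> q' = q'.-1./2.*2.+1 ->
    (\sum_(k <- iota 1 p'.-1./2) (q' * k) %/ p' =
     \sum_(k <- iota 1 p'.-1./2) \sum_(l <- iota 1 q'.-1./2) (p' * l <= q' * k))%N.
  move=> pp' hp' hq'; apply: eq_big_seq => k; rewrite mem_iota => hk.
  under eq_bigr do rewrite mulnC -leq_divRL ?prime_gt0 //.
  rewrite sum_iota_leq; apply/esym/minn_idPr.
  rewrite -ltnS ltn_divLR ?prime_gt0 //; nia.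
rewrite (fl p q) // (fl q p) // [X in (_ + X)%N]exchange_big /= -big_split /=.
rewrite (eq_big_seq (fun=> q.-1./2)).
  by rewrite big_const_seq count_predT size_iota iter_addn_0 mulnC.
move=> k; rewrite mem_iota => hk; rewrite -big_split /= (eq_big_seq (fun=> 1%N)).
  by rewrite big_const_seq count_predT size_iota iter_addn_0 mul1n.
move=> l; rewrite mem_iota => hl.
have : (p * l != q * k)%N.
  apply/eqP => e; have : (p %| q * k)%N by rewrite -e dvdn_mulr.
  rewrite Euclid_dvdM // dvdn_prime2 // (negbTE pnq) /= gtnNdvd //; lia.
by case: ltngtP.
Qed.

(** * Sums of real characters *)

Definition real_char (L : nat) (f : nat -> int) : Prop :=
  [/\ forall n, f (n + L)%N = f n, forall m n, f (m * n)%N = f m * f n,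
      forall n, coprime n L -> f n = 1 \/ f n = -1 &
      forall n, ~~ coprime n L -> f n = 0].

Definition nontriv_char (L : nat) (f : nat -> int) : Prop :=
  real_char L f /\ exists u, f u = -1.

Lemma real_charM L f g : real_char L f -> real_char L g ->
  real_char L (fun n => f n * g n).
Proof.
move=> [fp fm f1 f0] [gp gm g1 g0]; split=> [n|m n|n cn|n cn].
- by rewrite fp gp.
- by rewrite fm gm mulrACA.
- by case: (f1 n cn) => ->; case: (g1 n cn) => ->; [left|right|right|left].
- by rewrite f0 ?mul0r.
Qed.

Section RealChar.
Variables (L : nat) (f : nat -> int).
Hypothesis (L0 : (0 < L)%N) (cf : real_char L f).

Lemma real_char_mod n : f (n %% L)%N = f n.
Proof.
case: cf => fp _ _ _; rewrite [in RHS](divn_eq n L).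
by elim: (n %/ L)%N => [|k IH] //; rewrite mulSn -addnA addnC fp.
Qed.

Lemma real_char_le1 n : `|f n| <= 1.
Proof.
case: cf => _ _ f1 f0; have [cn|cn] := boolP (coprime n L); last by rewrite f0.
by case: (f1 n cn) => ->.
Qed.

Lemma real_char_eq1 : f 1 = 1.
Proof.
case: cf => _ fm f1 _; have := fm 1%N 1%N; rewrite muln1.
by case: (f1 1%N (coprime1n L)) => ->.
Qed.

End RealChar.

(** Multiplication by [u] permutes the residues and changes the sign of the sum. *)
Lemma nontriv_char_sum0 L f : (0 < L)%N -> nontriv_char L f ->
  \sum_(0 <= n < L) f n = 0.
Proof.
move=> L0 [cf [u fu]]; have [fp fm f1 f0] := cf.
have cu : coprime u L by apply/negP => /negP /f0; rewrite fu.
rewrite big_mkord.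
case: L L0 cf fp f1 f0 cu => // L' _ cf fp f1 f0 cu.
pose h (i : 'I_L'.+1) : 'I_L'.+1 := inZp (u * i).
have hinj : injective h.
  move=> i j /(congr1 val) /= /eqP e; apply: val_inj => /=.
  suff : i == j %[mod L'.+1] by rewrite !modn_small ?ltn_ord // => /eqP.
  wlog lij : i j e / (i <= j)%N.
    move=> H; case/orP: (leq_total i j) => [/H ->//|ji].
    by rewrite eq_sym H // eq_sym.
  rewrite eq_sym eqn_mod_dvd // -(@Gauss_dvdr _ u); last by rewrite coprime_sym.
  by rewrite mulnBr -eqn_mod_dvd ?leq_mul2l ?lij ?orbT // eq_sym.
have : \sum_(i < L'.+1) f i = - \sum_(i < L'.+1) f i.
  rewrite {1}(reindex_inj hinj) /= -sumrN; apply: eq_bigr => i _.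
  by rewrite (real_char_mod cf) fm fu mulN1r.
by move/eqP; rewrite -subr_eq0 opprK -mulr2n mulrn_eq0 => /eqP.
Qed.

(** Whole periods contribute 0; fewer than [L] terms remain, each of absolute value at most 1. *)
Lemma nontriv_char_sum_le L f u v : (0 < L)%N -> nontriv_char L f ->
  `|\sum_(u <= n < v) f n| <= L%:Z.
Proof.
move=> L0 nf; have [cf _] := nf; have [fp _ _ _] := cf.
have step w : \sum_(w <= n < w + L) f n = 0.
  elim: w => [|w IH]; first by rewrite add0n nontriv_char_sum0.
  have e : (w < w + L)%N by lia.
  by rewrite addSn big_nat_recr /= ?fp; last lia; rewrite addrC -big_ltn.
elim/ltn_ind: v => v IH; have [h|h] := leqP (u + L) v.
  rewrite (big_cat_nat _ (n := (v - L)%N)) /=; [|lia|lia].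
  have := step (v - L)%N; rewrite subnK; last lia.
  by move=> ->; rewrite addr0; apply: IH; lia.
apply: le_trans (ler_norm_sum _ _ _) _.
apply: (@le_trans _ _ (\sum_(u <= n < v) 1)).
  by apply: ler_sum => n _; apply: (real_char_le1 cf).
rewrite sumr_const_nat; lia.
Qed.

(** * Partial summation and the hyperbola method *)

Section Weights.
Variable R : rcfType.

(* Completely multiplicative, as the hyperbola method requires; isqrt 0 = 0. *)
Definition isqrt (n : nat) : R := (Num.sqrt n%:R)^-1.

Lemma isqrt_ge0 n : 0 <= isqrt n.
Proof. by rewrite invr_ge0 sqrtr_ge0. Qed.

Lemma isqrtM m n : isqrt (m * n) = isqrt m * isqrt n.
Proof. by rewrite /isqrt natrM sqrtrM ?ler0n // invfM. Qed.

Lemma sqrtn_gt0 n : (0 < n)%N -> 0 < Num.sqrt (n%:R : R).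
Proof. by move=> n0; rewrite sqrtr_gt0 ltr0n. Qed.

Lemma isqrt_anti m n : (0 < m <= n)%N -> isqrt n <= isqrt m.
Proof.
case/andP=> m0 mn; rewrite lef_pV2 ?posrE ?sqrtn_gt0 ?ler_wsqrtr ?ler_nat //.
exact: leq_trans m0 mn.
Qed.

Lemma sum_isqrt A : \sum_(1 <= a < A.+1) isqrt a <= 2%:R * Num.sqrt A%:R.
Proof.
elim: A => [|A IH]; first by rewrite big_geq // sqrtr0 mulr0.
rewrite big_nat_recr //=; apply: le_trans (lerD IH (lexx _)) _.
have h0 := sqrtn_gt0 (ltn0Sn A).
rewrite -lerBrDl -mulrBr /isqrt -(ler_pM2r h0) mulVf ?gt_eqF //.
have : Num.sqrt A%:R ^+ 2 + 1 = Num.sqrt (A.+1%:R : R) ^+ 2.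
  by rewrite !sqr_sqrtr ?ler0n // -natr1.
(* Multiplied by sqrt(A+1), the induction step 1 / sqrt(A+1) <= 2 (sqrt(A+1) - sqrt A) says that
   this square is nonnegative. *)
have := sqr_ge0 (Num.sqrt A%:R - Num.sqrt (A.+1%:R : R)).
nra.
Qed.

(** Summation by parts: the partial sums of [f] are bounded by [L] and the weights decrease, so the
    bound telescopes. *)
Lemma abel_bound L f u v : (0 < L)%N -> nontriv_char L f -> (0 < u)%N ->
  `|\sum_(u <= n < v) (f n)%:~R * isqrt n| <= L%:R * isqrt u.
Proof.
move=> L0 nf u0; have [h|h] := leqP v u.
  by rewrite big_geq // normr0 mulr_ge0 ?isqrt_ge0 ?ler0n.
pose S k : R := \sum_(u <= n < k) (f n)%:~R.
have Sb k : `|S k| <= L%:R.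
  rewrite /S -rmorph_sum /= -intr_norm -[L%:R]/(L%:Z%:~R) ler_int.
  exact: nontriv_char_sum_le.
have -> : \sum_(u <= n < v) (f n)%:~R * isqrt n =
   S v * isqrt v.-1 + \sum_(u <= k < v.-1) S k.+1 * (isqrt k - isqrt k.+1).
  case: v h => // v; rewrite ltnS => h; elim: v h => [|v IH] h; first lia.
  move: h; rewrite leq_eqVlt => /orP[/eqP <-|h].
    by rewrite /= /S !big_nat1 [X in _ + X]big_geq // addr0.
  rewrite big_nat_recr /=; last lia.
  rewrite IH //= [X in _ = _ + X]big_nat_recr //= /S [X in _ = X * _ + _]big_nat_recr /=; last lia.
  ring.
apply: le_trans (ler_normD _ _) _.
have -> : L%:R * isqrt u = L%:R * isqrt v.-1 + \sum_(u <= k < v.-1) L%:R * (isqrt k - isqrt k.+1).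
  rewrite -big_distrr -mulrDr /=; congr (_ * _).
  have -> : \sum_(u <= k < v.-1) (isqrt k - isqrt k.+1) = isqrt u - isqrt v.-1.
    have e : (u <= v.-1)%N by lia.
    rewrite -[RHS]opprB -telescope_sumr // -sumrN.
    by apply: eq_bigr => k _; rewrite opprB.
  by ring.
apply: lerD; first by rewrite normrM [`|isqrt _|]ger0_norm ?isqrt_ge0 ?ler_wpM2r ?isqrt_ge0.
apply: le_trans (ler_norm_sum _ _ _) _.
rewrite big_nat_cond [leRHS]big_nat_cond.
apply: ler_sum => k /andP[/andP[hk _] _].
have d0 : 0 <= isqrt k - isqrt k.+1.
  by rewrite subr_ge0 isqrt_anti // leqnSn andbT; lia.
by rewrite normrM [`|isqrt _ - _|]ger0_norm ?ler_wpM2r.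
Qed.

Lemma sum_hyperbola_row (G : nat -> R) X a m : (0 < a)%N ->
  \sum_(m <= b < X.+1 | (a * b <= X)%N) G b = \sum_(m <= b < (X %/ a).+1) G b.
Proof.
move=> a0; rewrite [RHS](big_nat_widen _ _ X.+1) ?ltnS ?leq_div //.
by apply: eq_bigl => b; rewrite /= ltnS leq_divRL // mulnC.
Qed.

(* The inner sum is O(1 / sqrt A) by Abel summation, and the outer weights add
   up to O(sqrt A). *)
Lemma hyperbola_tail L f g A : (0 < L)%N -> nontriv_char L f -> nontriv_char L g ->
  `|\sum_(1 <= a < A.+1) ((f a)%:~R * isqrt a) *
     \sum_(A.+1 <= b < (A ^ 2 %/ a).+1) (g b)%:~R * isqrt b| <= (2 * L)%:R.
Proof.
move=> L0 [cf _] ng; apply: le_trans (ler_norm_sum _ _ _) _.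
apply: (@le_trans _ _ (\sum_(1 <= a < A.+1) isqrt a * (L%:R * isqrt A.+1))).
  apply: ler_sum => a _; rewrite normrM.
  apply: ler_pM; rewrite ?normr_ge0 //; last exact: abel_bound.
  rewrite normrM [`|isqrt _|]ger0_norm ?isqrt_ge0 // ler_piMl ?isqrt_ge0 //.
  by rewrite -intr_norm -[1]/(1%:~R) ler_int (real_char_le1 cf).
rewrite -big_distrl /=.
have h0 := sqrtn_gt0 (ltn0Sn A).
apply: (@le_trans _ _ (2%:R * Num.sqrt A.+1%:R * (L%:R * isqrt A.+1))).
  apply: ler_wpM2r; first by rewrite mulr_ge0 ?isqrt_ge0 ?ler0n.
  apply: le_trans (sum_isqrt _) _; apply: ler_wpM2l; first exact: ler0n.
  by rewrite ler_wsqrtr ?ler_nat.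
by rewrite mulrACA /isqrt mulfV ?gt_eqF // mulr1 natrM.
Qed.

(** The pairs with a b <= A^2 form the full square a, b <= A and two tails, as a and b cannot both
    exceed A. The square is a product of two sums bounded by L; each tail is at most 2 L. *)
Lemma hyperbola_bound L f g A : (0 < L)%N -> nontriv_char L f -> nontriv_char L g ->
  `|\sum_(1 <= a < (A ^ 2).+1) \sum_(1 <= b < (A ^ 2).+1 | (a * b <= A ^ 2)%N)
     ((f a)%:~R * isqrt a) * ((g b)%:~R * isqrt b)| <= (L * L + 4 * L)%:R.
Proof.
move=> L0 nf ng; set X := (A ^ 2)%N.
pose F a : R := (f a)%:~R * isqrt a; pose G b : R := (g b)%:~R * isqrt b.
have AX : (A <= X)%N by rewrite /X; nia.
rewrite (big_cat_nat _ (n := A.+1)) //=.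
have -> : \sum_(1 <= a < A.+1) \sum_(1 <= b < X.+1 | (a * b <= X)%N) F a * G b =
  (\sum_(1 <= a < A.+1) F a) * (\sum_(1 <= b < A.+1) G b) +
  \sum_(1 <= a < A.+1) F a * \sum_(A.+1 <= b < (X %/ a).+1) G b.
  rewrite big_distrl -big_split /=.
  apply: eq_big_nat => a /andP[a0 aA].
  rewrite sum_hyperbola_row // -big_distrr /= -mulrDr; congr (_ * _).
  rewrite (big_cat_nat _ (n := A.+1)) //= ltnS leq_divRL // /X; nia.
have -> : \sum_(A.+1 <= a < X.+1) \sum_(1 <= b < X.+1 | (a * b <= X)%N) F a * G b =
  \sum_(1 <= b < A.+1) G b * \sum_(A.+1 <= a < (X %/ b).+1) F a.
  under eq_bigr do rewrite big_mkcond.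
  rewrite exchange_big /= (big_cat_nat _ (n := A.+1)) //=.
  rewrite [X in _ + X]big1_seq ?addr0; last first.
    move=> b /andP[_]; rewrite mem_index_iota => hb; rewrite big1_seq // => a /andP[_].
    rewrite mem_index_iota => ha; case: ifP => //; rewrite /X; nia.
  apply: eq_big_nat => b /andP[b0 bA]; rewrite -sum_hyperbola_row // big_distrr /= [RHS]big_mkcond /=.
  by apply: eq_bigr => a _; rewrite mulnC mulrC.
apply: le_trans (ler_normD _ _) _.
have -> : (L * L + 4 * L)%:R = (L * L)%:R + (2 * L)%:R + (2 * L)%:R :> R.
  by rewrite -!natrD; congr _%:R; lia.
apply: lerD; last exact: hyperbola_tail.
apply: le_trans (ler_normD _ _) _.
apply: lerD; last exact: hyperbola_tail.
have i1 : isqrt 1 = 1 by rewrite /isqrt sqrtr1 invr1.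
rewrite normrM natrM; apply: ler_pM; rewrite ?normr_ge0 //.
  by have := @abel_bound L f 1 A.+1 L0 nf isT; rewrite i1 mulr1.
by have := @abel_bound L g 1 A.+1 L0 ng isT; rewrite i1 mulr1.
Qed.

End Weights.

(** * Divisor sums of a real character *)

Lemma pfactor_split (q n : nat) : prime q -> (0 < n)%N ->
  exists2 m, (0 < m)%N && ~~ (q %| m)%N & n = (q ^ logn q n * m)%N.
Proof.
move=> pq n0; have [m cqm e] := pfactor_coprime pq n0; exists m.
  rewrite -prime_coprime // cqm andbT lt0n; apply/eqP => m0; by rewrite e m0 in n0.
by rewrite mulnC.
Qed.

Lemma pfactor_ind (P : nat -> Prop) : P 1%N ->
  (forall q e m, prime q -> (0 < m)%N -> ~~ (q %| m)%N -> P m -> P (q ^ e.+1 * m)%N) ->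
  forall n, (0 < n)%N -> P n.
Proof.
move=> P1 PS; elim/ltn_ind => n IH n0.
have [->//|n1] := eqVneq n 1%N.
have n2 : (1 < n)%N by lia.
have pq := pdiv_prime n2; have [m /andP[m0 qm] e] := pfactor_split pq n0.
have l0 : (0 < logn (pdiv n) n)%N by rewrite logn_gt0 mem_primes pq n0 pdiv_dvd.
have q1 := prime_gt1 pq.
rewrite e; case: (logn _ _) l0 e => // k _ e; apply: PS => //; apply: IH => //.
by rewrite [X in (_ < X)%N]e ltn_Pmull // (ltn_exp2l 0).
Qed.

Definition divsum (f : nat -> int) (m : nat) : int := \sum_(d <- divisors m) f d.

Section DivSum.
Variables (L : nat) (f : nat -> int).
Hypothesis cf : real_char L f.

(* The divisors of q^(e+1) m are q times those of q^e m, and those of m. *)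
Lemma divsum_pfactor q e m : prime q -> (0 < m)%N -> ~~ (q %| m)%N ->
  divsum f (q ^ e.+1 * m) = f q * divsum f (q ^ e * m) + divsum f m.
Proof.
move=> pq m0 qm; have [fp fm _ _] := cf; have q0 := prime_gt0 pq.
have n0 k : (0 < q ^ k * m)%N by rewrite muln_gt0 expn_gt0 q0.
rewrite /divsum (bigID (fun d => q %| d)%N) /= -!(big_filter (divisors (q ^ e.+1 * m))).
congr (_ + _).
  rewrite big_distrr /=.
  rewrite (perm_big [seq (q * d)%N | d <- divisors (q ^ e * m)]) /=.
    by rewrite big_map; apply: eq_bigr => d _; rewrite fm.
  apply: uniq_perm; rewrite ?filter_uniq ?divisors_uniq //.
    rewrite map_inj_uniq ?divisors_uniq // => x y /eqP.
    by rewrite eqn_pmul2l // => /eqP.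
  move=> d; rewrite mem_filter -dvdn_divisors // expnS -mulnA.
  apply/andP/mapP => [[/dvdnP[k ->]]|[k hk ->]].
    rewrite mulnC dvdn_pmul2l // => hk; exists k => //.
    by rewrite -dvdn_divisors.
  by move: hk; rewrite -dvdn_divisors // dvdn_pmul2l // => hk; split=> //; apply: dvdn_mulr.
apply: perm_big; apply: uniq_perm; rewrite ?filter_uniq ?divisors_uniq //.
move=> d; rewrite mem_filter -!dvdn_divisors //.
apply/andP/idP => [[qd]|dm].
  by rewrite Gauss_dvdr // coprimeXr // coprime_sym prime_coprime.
by split; [apply: contra qm => /dvdn_trans; apply|apply: dvdn_mull].
Qed.

Definition geom_sum (s : int) (e : nat) : int := \sum_(j < e.+1) s ^+ j.

(** Multiplicativity, one prime at a time: sign and vanishing of a divisor sum become questions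
    about the local factors [geom_sum]. *)
Lemma divsum_split q e m : prime q -> (0 < m)%N -> ~~ (q %| m)%N ->
  divsum f (q ^ e * m) = geom_sum (f q) e * divsum f m.
Proof.
move=> pq m0 qm; elim: e => [|e IH].
  by rewrite expn0 mul1n /geom_sum big_ord1 mul1r.
rewrite divsum_pfactor // IH /geom_sum [in RHS]big_ord_recl.
under [in RHS]eq_bigr do rewrite lift0 exprS.
by rewrite -big_distrr /= mulrDl mul1r mulrA addrC.
Qed.

Lemma sum_signs e : \sum_(j < e.+1) (-1 : int) ^+ j = (~~ odd e)%:R.
Proof.
elim: e => [|k IHk]; first by rewrite big_ord1.
by rewrite big_ord_recr /= IHk -signr_odd /=; case: (odd k).
Qed.

Lemma geom_sumE n e : geom_sum (f n) e =
  if f n == 1 then e.+1%:R else if f n == 0 then 1 else (~~ odd e)%:R.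
Proof.
rewrite /geom_sum; case: eqP => [->|n1].
  under eq_bigr do rewrite expr1n.
  by rewrite sumr_const card_ord.
case: eqP => [->|n0].
  rewrite big_ord_recl big1 ?addr0 ?expr0 // => i _; by rewrite expr0n.
case: cf => _ _ f1 f0; case: (boolP (coprime n L)) => [/f1[]|/f0] // ->.
exact: sum_signs.
Qed.

Lemma geom_sum_ge0 n e : 0 <= geom_sum (f n) e.
Proof. by rewrite geom_sumE; case: ifP => // _; case: ifP => // _; case: (odd e). Qed.

Lemma divsum1 : divsum f 1 = 1.
Proof.
rewrite /divsum (_ : divisors 1 = [:: 1%N]) // big_seq1; exact: (real_char_eq1 cf).
Qed.

Lemma divsum_ge0 m : (0 < m)%N -> 0 <= divsum f m.
Proof.
move: m; apply: pfactor_ind => [|q e m pq m0 qm IH]; first by rewrite divsum1.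
by rewrite divsum_split // mulr_ge0 // geom_sum_ge0.
Qed.

Lemma divsum_sqr_ge1 m : (0 < m)%N -> 1 <= divsum f (m * m).
Proof.
move: m; apply: pfactor_ind => [|q e m pq m0 qm IH]; first by rewrite divsum1.
rewrite mulnACA -expnD divsum_split ?muln_gt0 ?m0 //; last by rewrite Euclid_dvdM // negb_or qm.
have : 1 <= geom_sum (f q) (e.+1 + e.+1).
  by rewrite geom_sumE; case: ifP => _; [rewrite ler1n|case: ifP => // _; rewrite oddD addbb].
by nia.
Qed.

(** Whether a local factor vanishes depends only on f q and on the parity of the exponent, which
    changes by 2. *)
Lemma divsum_drop_sqr q m : prime q -> (0 < m)%N -> 0 < divsum f (q * q * m) ->
  0 < divsum f m.
Proof.
move=> pq m0; have [k /andP[k0 qk] e] := pfactor_split pq m0.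
rewrite e -[in (q * q)%N](expn1 q) mulnA -!expnD !divsum_split //.
rewrite !geom_sumE (_ : odd _ = odd (logn q m)); last by rewrite /= negbK.
case: ifP => _; first by rewrite !pmulr_rgt0 ?ltr0n.
by case: ifP => _ //; case: (odd _); rewrite /= ?mul0r.
Qed.

(** As q divides q m exactly once, f q = -1 would make the local factor 1 + f q vanish. *)
Lemma divsum_gt0_prime q m : prime q -> (0 < m)%N -> coprime q L -> ~~ (q %| m)%N ->
  0 < divsum f (q * m) -> f q = 1.
Proof.
move=> pq m0 cq qm; rewrite -[q in divsum _ (q * _)]expn1 divsum_split //.
by rewrite geom_sumE; case: cf => _ _ f1 _; case: (f1 q cq) => -> //=; rewrite mul0r.
Qed.

(** A prime with f q = -1 and odd exponent makes the divisor sum 0, so f m = 1 wherever the sum is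
    nonzero. *)
Lemma divsum_char m : (0 < m)%N -> coprime m L -> f m * divsum f m = divsum f m.
Proof.
move: m; apply: pfactor_ind => [|q e m pq m0 qm IH].
  by rewrite (real_char_eq1 cf) mul1r.
rewrite coprimeMl => /andP[cq /IH {}IH]; have [_ fm f1 _] := cf.
rewrite divsum_split // fm mulrACA IH; congr (_ * _).
have -> : f (q ^ e.+1)%N = f q ^+ e.+1.
  elim: (e.+1) => [|k IHk]; first by rewrite (real_char_eq1 cf).
  by rewrite expnS fm IHk exprS.
rewrite geom_sumE; rewrite coprime_pexpl // in cq.
case: (f1 q cq) => -> /=; first by rewrite expr1n mul1r.
by rewrite -signr_odd /=; case: (odd e).
Qed.

End DivSum.

(** * Integers with prescribed real characters *)

Section Harmonic.
Variable R : rcfType.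

(** The dyadic block from 2^t + 1 to 2^(t+1) contributes at least 1/2. *)
Lemma harmonic_ge t : t%:R / 2 <= \sum_(1 <= j < (2 ^ t).+1) j%:R^-1 :> R.
Proof.
elim: t => [|t IH]; first by rewrite mul0r sumr_ge0 // => i _; rewrite invr_ge0 ler0n.
rewrite (big_cat_nat _ (n := (2 ^ t).+1)) //=; last by rewrite ltnS leq_exp2l.
rewrite -natr1 mulrDl; apply: lerD => //.
apply: (@le_trans _ _ (\sum_((2 ^ t).+1 <= j < (2 ^ t.+1).+1) ((2 ^ t.+1)%:R^-1 : R))).
  rewrite sumr_const_nat subSS (_ : 2 ^ t.+1 - 2 ^ t = 2 ^ t)%N; last by rewrite expnS; lia.
  by rewrite -[leRHS]mulr_natr expnS natrM invfM -mulrA mulVf ?mulr1 ?mul1r // pnatr_eq0 expn_eq0.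
apply: ler_sum_nat => j /andP[h1 h2].
by rewrite lef_pV2 ?posrE ?ltr0n ?ler_nat ?expn_gt0 //; lia.
Qed.

Lemma sum_sub_ge (G : nat -> R) (h : nat -> nat) n :
  (forall m, 0 <= G m) -> (forall k, (h k < h k.+1)%N) ->
  \sum_(1 <= k < n.+1) G (h k) <= \sum_(1 <= m < (h n).+1) G m.
Proof.
move=> G0 hS; elim: n => [|n IH]; first by rewrite [leLHS]big_geq ?sumr_ge0.
rewrite big_nat_recr //= [leRHS](big_cat_nat _ (n := (h n).+1)) //=; last by rewrite ltnW // ltnS.
apply: lerD => //; rewrite big_nat_recr //=.
by rewrite lerDr; apply: sumr_ge0 => m _; apply: G0.
Qed.

Lemma coprime_harmonic L K : (0 < L)%N ->
  exists T : nat, K%:R <= \sum_(1 <= k < T.+1) (coprime k L)%:R / k%:R :> R.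
Proof.
(* The numbers j L + 1 are prime to [L] and at most j (L + 1) for j >= 1. Since the harmonic sum up
   to 2^t is at least t / 2, this [t] makes it at least (L + 1) K. *)
move=> L0; pose t := (2 * L.+1 * K)%N; exists ((2 ^ t) * L + 1)%N.
pose h j := (j * L + 1)%N.
have := @sum_sub_ge (fun k => (coprime k L)%:R / k%:R) h (2 ^ t) _ _.
rewrite -/(h (2 ^ t)%N) => H; apply: (le_trans _ (H _ _)).
- apply: (@le_trans _ _ (\sum_(1 <= j < (2 ^ t).+1) (j%:R^-1 * L.+1%:R^-1))).
    rewrite -big_distrl /= ler_pdivlMr ?ltr0n //.
    apply: le_trans (harmonic_ge _).
    by rewrite /t !natrM; lra.
  apply: ler_sum_nat => j /andP[h1 h2].
  have -> : coprime (h j) L by rewrite /h coprime_sym /coprime gcdnMDl gcdn1.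
  rewrite mul1r -invfM -natrM lef_pV2 ?posrE ?ltr0n ?ler_nat /h ?muln_gt0 ?h1 //; nia.
- by move=> m; rewrite divr_ge0 ?ler0n.
- by move=> k; rewrite /h; nia.
Qed.

End Harmonic.

Lemma sum_divisors_hyperbola (V : nmodType) (H : nat -> nat -> V) X :
  \sum_(1 <= m < X.+1) \sum_(d <- divisors m) H d m =
  \sum_(1 <= a < X.+1) \sum_(1 <= b < X.+1 | (a * b <= X)%N) H a (a * b)%N.
Proof.
have -> : \sum_(1 <= m < X.+1) \sum_(d <- divisors m) H d m =
   \sum_(1 <= m < X.+1) \sum_(1 <= a < X.+1 | (a %| m)%N) H a m.
  apply: eq_big_nat => m /andP[m0 mX]; rewrite -[RHS]big_filter; apply: perm_big.
  apply: uniq_perm; rewrite ?filter_uniq ?divisors_uniq ?iota_uniq // => d.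
  rewrite mem_filter -dvdn_divisors // mem_index_iota; case: (boolP (d %| m)%N) => //= dm.
  have := dvdn_leq m0 dm; have := dvdn_gt0 m0 dm; lia.
under eq_bigr do rewrite big_mkcond.
rewrite exchange_big /=; apply: eq_big_nat => a /andP[a0 aX].
rewrite -big_mkcond -big_filter -[RHS]big_filter /=.
rewrite -(big_map (fun b => (a * b)%N) xpredT (H a)); apply: perm_big.
apply: uniq_perm; rewrite ?filter_uniq ?iota_uniq //.
  rewrite map_inj_uniq ?filter_uniq ?iota_uniq // => x y /eqP.
  by rewrite eqn_pmul2l // => /eqP.
move=> m; rewrite mem_filter mem_index_iota; apply/idP/mapP.
  move=> /andP[/dvdnP[k ->] hk]; exists k; last by rewrite mulnC.
  rewrite mem_filter mem_index_iota; nia.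
move=> [k]; rewrite mem_filter mem_index_iota => hk ->; rewrite dvdn_mulr //=; nia.
Qed.

Section Existence.
Variables (I : finType) (L : nat) (psi : I -> nat -> int).
Hypothesis L0 : (0 < L)%N.
Hypothesis cpsi : forall i, real_char L (psi i).
Hypothesis indep : forall i, exists u, [/\ coprime u L, psi i u = -1 &
  forall j, j != i -> psi j u = 1].

(** The coprimality factor makes the empty product the principal character modulo [L]. *)
Definition char_prod (A : {set I}) (n : nat) : int :=
  (coprime n L)%:R * \prod_(i in A) psi i n.

Lemma char_prod_real A : real_char L (char_prod A).
Proof.
split=> [n|m n|n cn|n cn].
- rewrite /char_prod /coprime ![gcdn _ L]gcdnC gcdnDr; congr (_ * _).
  by apply: eq_bigr => i _; case: (cpsi i).
- rewrite /char_prod coprimeMl mulrACA -natrM mulnb; congr (_ * _).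
  by rewrite -big_split; apply: eq_bigr => i _ /=; case: (cpsi i).
- rewrite /char_prod cn mul1r; elim/big_ind: _ => [|x y|i _]; first by left.
    by case=> ->; case=> ->; [left|right|right|left].
  by case: (cpsi i) => _ _ h _; apply: h.
- by rewrite /char_prod (negbTE cn) mul0r.
Qed.

Lemma char_prod0 n : char_prod set0 n = (coprime n L)%:R.
Proof. by rewrite /char_prod big_set0 mulr1. Qed.

Lemma char_prod_indep A i u : coprime u L -> psi i u = -1 ->
  (forall j, j != i -> psi j u = 1) -> char_prod A u = (-1) ^+ (i \in A).
Proof.
move=> cu ui uj; rewrite /char_prod cu mul1r; case: (boolP (i \in A)) => iA.
  rewrite (bigD1 i) //= ui big1 ?mulr1 // => j /andP[_]; exact: uj.
by rewrite big1 // => j jA; apply: uj; apply: contraNneq iA => <-.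
Qed.

Lemma char_prod_nontriv A : A != set0 -> nontriv_char L (char_prod A).
Proof.
case/set0Pn => i iA; split; first exact: char_prod_real.
have [u [cu ui uj]] := indep i; exists u.
by rewrite (char_prod_indep A cu ui uj) iA.
Qed.

(** Take an index in the symmetric difference of A and B, and a point where its character alone is
    -1. *)
Lemma char_prod_nontrivM A B : A != B -> nontriv_char L (fun n => char_prod A n * char_prod B n).
Proof.
move=> AB; split; first by apply: real_charM; apply: char_prod_real.
have [i iAB] : exists i, (i \in A) != (i \in B).
  by apply/existsP; apply: contraNT AB; rewrite negb_exists => /forallP h;
     apply/eqP/setP => i; apply/eqP; rewrite -[_ == _]negbK.
have [u [cu ui uj]] := indep i; exists u.
rewrite !(char_prod_indep _ cu ui uj).
by case: (i \in A) iAB; case: (i \in B).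
Qed.

Variables (J : {set I}) (eps : I -> int).
Hypothesis J0 : J != set0.
Hypothesis eps1 : forall i, eps i = 1 \/ eps i = -1.
Hypothesis epsJ : \prod_(i in J) eps i = 1.

Definition wsum (R : rcfType) (A : {set I}) (X : nat) : R :=
  \sum_(1 <= m < X.+1) (divsum (char_prod J) m * char_prod A m)%:~R * isqrt R m.

(** Writing m = a b, with a the divisor, separates the summand into [char_prod J] times
    [char_prod A] at a and [char_prod A] at b. Both are nontrivial since A differs from J and is
    nonempty. *)
Lemma wsum_bound (R : rcfType) A T : A != set0 -> A != J ->
  `|wsum R A (T ^ 2)| <= (L * L + 4 * L)%:R.
Proof.
move=> A0 AJ; apply: le_trans (hyperbola_bound R T L0 (char_prod_nontrivM AJ) (char_prod_nontriv A0)).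
rewrite le_eqVlt; apply/orP; left; apply/eqP; congr `|_|.
rewrite /wsum.
have [_ fm _ _] := char_prod_real A.
rewrite [RHS](_ : _ = \sum_(1 <= m < (T ^ 2).+1) \sum_(d <- divisors m)
    (char_prod J d * char_prod A m)%:~R * isqrt R m).
  by apply: eq_bigr => m _; rewrite /divsum big_distrl rmorph_sum big_distrl.
rewrite (sum_divisors_hyperbola (fun d m => (char_prod J d * char_prod A m)%:~R * isqrt R m)).
apply: eq_bigr => a _; apply: eq_bigr => b _.
by rewrite fm isqrtM !rmorphM /=; ring.
Qed.

Lemma wsum_J (R : rcfType) X : wsum R J X = wsum R set0 X.
Proof.
apply: eq_big_nat => m /andP[m0 _]; congr (_%:~R * _).
rewrite char_prod0; case: (boolP (coprime m L)) => cm.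
  by rewrite mulr1 mulrC (divsum_char (char_prod_real J)).
by case: (char_prod_real J) => _ _ _ ->; rewrite ?mulr0.
Qed.

(** All terms are nonnegative; keep only m = k^2, where the divisor sum is at least 1 and the weight
    is 1 / k. A divergent harmonic sum remains. *)
Lemma wsum_set0_ge (R : rcfType) K : exists T, K%:R <= wsum R set0 (T ^ 2).
Proof.
have [T hT] := coprime_harmonic R K L0; exists T.
pose G m : R := if (0 < m)%N then (divsum (char_prod J) m * char_prod set0 m)%:~R * isqrt R m else 0.
have -> : wsum R set0 (T ^ 2) = \sum_(1 <= m < (T ^ 2).+1) G m.
  by apply: eq_big_nat => m /andP[m0 _]; rewrite /G m0.
have := @sum_sub_ge R G (fun k => k ^ 2)%N T.
move=> H; apply: (le_trans _ (H _ _)).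
- apply: le_trans hT _; apply: ler_sum_nat => k /andP[k0 _].
  rewrite /G expn_gt0 k0 char_prod0 coprime_pexpl //.
  rewrite /isqrt natrX sqrtr_sqr ger0_norm ?ler0n //; apply: ler_wpM2r.
    by rewrite invr_ge0 ler0n.
  have := divsum_sqr_ge1 (char_prod_real J) k0; rewrite mulnn => h1.
  rewrite rmorphM /= rmorph_nat; apply: ler_peMl; first by rewrite ler0n.
  by rewrite -[1]/(1%:~R) ler_int.
- move=> m; rewrite /G; case: ifP => // m0; rewrite mulr_ge0 ?isqrt_ge0 // ler0z.
  by rewrite mulr_ge0 ?(divsum_ge0 (char_prod_real J)) // char_prod0 ler0n.
by move=> k; rewrite ltn_exp2r.
Qed.

(* The product of the 1 + eps i * psi i m detects the required m.  Expanded over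
   subsets A of I it is a sum of the wsum A; the terms for A = set0 and A = J
   coincide and are unbounded, all the others are bounded. *)
Lemma exists_divsum_gt0_rcf (R : rcfType) : exists m, [/\ (0 < m)%N, coprime m L,
  0 < divsum (char_prod J) m & forall i, psi i m = eps i].
Proof.
(* The constant exceeds the sum of the bounds of [wsum_bound] over all subsets of [I]. *)
have [T hT] := wsum_set0_ge R (#|{set I}| * (L * L + 4 * L)).+1.
pose ok m := [&& (0 < m)%N, coprime m L, 0 < divsum (char_prod J) m & [forall i, psi i m == eps i]].
have [/hasP[m _ /and4P[m0 cm dm /forallP em]]|/hasPn none] :=
  boolP (has ok (index_iota 1 (T ^ 2).+1)).
  by exists m; split=> // i; apply/eqP.
exfalso; pose X := (T ^ 2)%N.
have eA (A : {set I}) : \prod_(i in A) eps i = 1 \/ \prod_(i in A) eps i = -1.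
  elim/big_ind: _ => [|x y|i _]; [by left| |exact: eps1].
  by case=> ->; case=> ->; [left|right|right|left].
(* Each m in range contributes 0: it is not prime to [L], or its divisor sum is 0, or some factor 1
   + eps i psi i m is 0. *)
have total : \sum_(A : {set I}) (\prod_(i in A) eps i)%:~R * wsum R A X = 0.
  rewrite /wsum; under eq_bigr do rewrite big_distrr /=.
  rewrite exchange_big /= big1_seq // => m /andP[_ hm].
  have := none m hm; move: hm; rewrite mem_index_iota => /andP[m0 _].
  rewrite /ok m0 /=.
  have -> : \sum_(A : {set I}) (\prod_(i in A) eps i)%:~R *
      ((divsum (char_prod J) m * char_prod A m)%:~R * isqrt R m) =
    ((coprime m L)%:R * divsum (char_prod J) m * \prod_i (eps i * psi i m + 1))%:~R * isqrt R m.
    rewrite bigA_distr big_distrr rmorph_sum big_distrl /=; apply: eq_bigr => A _.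
    rewrite mulrA -rmorphM /=; congr (_%:~R * _); rewrite /char_prod -big_mkcond big_split /=.
    ring.
  have [cm|cm] := boolP (coprime m L); last by move=> _; rewrite /= mulr0n !mul0r ?mulr0z ?mul0r.
  case: (boolP (0 < _)) => [dm|dm _]; last first.
    have /eqP -> : divsum (char_prod J) m == 0.
      by rewrite eq_le (divsum_ge0 (char_prod_real J) m0) andbT leNgt.
    by rewrite mulr0 mul0r mulr0z mul0r.
  rewrite negb_forall => /existsP[i hi].
  rewrite (bigD1 i) //= (_ : eps i * psi i m + 1 = 0) ?(mul0r, mulr0, mulr0z) //.
  have [_ _ f1 _] := cpsi i; case: (eps1 i) hi => ->; case: (f1 m cm) => -> //.
pose C := (L * L + 4 * L)%N.
have oth : `|\sum_(A : {set I} | (A != set0) && (A != J))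
    (\prod_(i in A) eps i)%:~R * wsum R A X| <= (#|{set I}| * C)%:R.
  apply: le_trans (ler_norm_sum _ _ _) _.
  apply: (@le_trans _ _ (\sum_(A : {set I} | (A != set0) && (A != J)) C%:R)).
    apply: ler_sum => A /andP[A0 AJ]; rewrite normrM.
    have -> : `|(\prod_(i in A) eps i)%:~R : R| = 1.
      by case: (eA A) => ->; rewrite ?rmorphN1 ?normrN1 ?normr1.
    by rewrite mul1r; apply: wsum_bound.
  by rewrite sumr_const -mulrnA ler_nat mulnC leq_mul2r max_card orbT.
move: total; rewrite (bigD1 set0) //= (bigD1 J) //= big_set0 epsJ wsum_J !mul1r.
move: hT oth; rewrite -/X -/C -natr1 ler_norml => hT /andP[h1 h2].
have := ler0n R (#|{set I}| * C); move: (_%:R) h1 h2 hT => K.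
move: (wsum _ _ _) (\sum_(_ | _) _) => w s h1 h2 hT K0 e.
by lra.
Qed.

(** The estimates are finite and take no limit, so the real algebraic numbers can serve as the field
    of weights. *)
Lemma exists_divsum_gt0 : exists m, [/\ (0 < m)%N, coprime m L,
  0 < divsum (char_prod J) m & forall i, psi i m = eps i].
Proof. exact: exists_divsum_gt0_rcf realalg. Qed.

(* A minimal m with positive divisor sum is squarefree, since removing the square
   of a prime changes neither the characters nor the sign of the divisor sum. *)
Lemma exists_split_squarefree : exists c, [/\ (0 < c)%N, coprime c L,
  forall i, psi i c = eps i,
  forall q, prime q -> ~~ (q * q %| c)%N &
  forall q, prime q -> (q %| c)%N -> \prod_(i in J) psi i q = 1].
Proof.
pose ok c := [&& (0 < c)%N, coprime c L, 0 < divsum (char_prod J) c & [forall i, psi i c == eps i]].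
have ex : exists c, ok c.
  have [m [m0 cm dm em]] := exists_divsum_gt0.
  by exists m; rewrite /ok m0 cm dm; apply/forallP => i; rewrite em.
case: (ex_minnP ex) => c /and4P[c0 cc dc /forallP ec] cmin.
have sqf q : prime q -> ~~ (q * q %| c)%N.
  move=> pq; apply/negP => /dvdnP[k e].
  have k0 : (0 < k)%N by move: c0; rewrite e muln_gt0 => /andP[].
  move: cc; rewrite e !coprimeMl => /and3P[ck cq _].
  suff /cmin : ok k by rewrite e leqNgt ltn_Pmulr // (@ltn_mul 1 1) ?prime_gt1.
  rewrite /ok k0 ck /=; apply/andP; split.
    by apply: (divsum_drop_sqr (char_prod_real J) pq k0); rewrite mulnC -e.
  apply/forallP => i; rewrite -(eqP (ec i)) e; have [_ fm f1 _] := cpsi i.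
  by rewrite !fm; case: (f1 q cq) => ->; rewrite ?mulr1 // mulrNN mulr1.
exists c; split=> // [i|q pq /dvdnP[k e]]; first exact/eqP.
have k0 : (0 < k)%N by move: c0; rewrite e muln_gt0 => /andP[].
have cq : coprime q L by move: cc; rewrite e coprimeMl => /andP[].
have qk : ~~ (q %| k)%N.
  by apply: contra (sqf q pq) => /dvdnP[l ek]; rewrite e ek -mulnA dvdn_mull.
have := divsum_gt0_prime (char_prod_real J) pq k0 cq qk.
by rewrite mulnC -e /char_prod cq mul1r; apply.
Qed.

End Existence.

(** * The quadratic characters of a set of odd primes *)

(* The tags 4 and 8 stand for n |-> (-1/n) and n |-> (2/n), any other tag for the
   Legendre symbol; only odd n are meant for the first two. *)
Definition qchar (t n : nat) : int :=
  if t == 4%N then if (n %% 4 == 1)%N then 1 else -1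
  else if t == 8%N then if (n %% 8 == 1)%N || (n %% 8 == 7)%N then 1 else -1
  else legendre t n.

Definition odd_primes (ps : seq nat) := uniq ps /\ {in ps, forall p, prime p && odd p}.

Definition qchar_tags (ps : seq nat) := [:: 4%N, 8%N & ps].

Definition qchar_mod (ps : seq nat) : nat := (8 * \prod_(p <- ps) p)%N.

Lemma odd_mod8 n : odd n -> [\/ n %% 8 = 1, n %% 8 = 3, n %% 8 = 5 | n %% 8 = 7]%N.
Proof.
rewrite {1}(divn_eq n 8) oddD oddM andbF /=; have := @ltn_pmod n 8 isT.
by case: (n %% 8)%N => [|[|[|[|[|[|[|[|]]]]]]]] // _ _; constructor.
Qed.

Lemma modn8_4 n : (n %% 4 = (n %% 8) %% 4)%N.
Proof. by rewrite modn_dvdm. Qed.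

Lemma qchar4M m n : odd m -> odd n -> qchar 4 (m * n) = qchar 4 m * qchar 4 n.
Proof.
move=> om on; rewrite /qchar /= -modnMm !(modn8_4 m) !(modn8_4 n).
by case: (odd_mod8 om) => ->; case: (odd_mod8 on) => ->.
Qed.

Lemma qchar8M m n : odd m -> odd n -> qchar 8 (m * n) = qchar 8 m * qchar 8 n.
Proof.
move=> om on; rewrite /qchar /= -modnMm.
by case: (odd_mod8 om) => ->; case: (odd_mod8 on) => ->.
Qed.

Lemma odd_prime_tag p : prime p -> odd p -> (p != 4) && (p != 8).
Proof. by move=> pp op; apply/andP; split; apply: contraTneq pp => ->. Qed.

Lemma qchar_prime p n : prime p -> odd p -> qchar p n = legendre p n.
Proof. by move=> pp op; rewrite /qchar; have /andP[/negbTE-> /negbTE->] := odd_prime_tag pp op. Qed.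

Section QChar.
Variable ps : seq nat.
Hypothesis hps : odd_primes ps.

Lemma qchar_mod_gt0 : (0 < qchar_mod ps)%N.
Proof.
have [_ hp] := hps; rewrite muln_gt0 big_seq /=; apply: prodn_cond_gt0 => p /hp.
by case/andP => /prime_gt0.
Qed.

Lemma coprime_prodr n (s : seq nat) :
  coprime n (\prod_(p <- s) p)%N = all (coprime n) s.
Proof. by elim: s => [|p s IH]; rewrite ?big_nil ?coprimen1 // big_cons coprimeMr IH. Qed.

Lemma coprime_qchar_mod n : coprime n (qchar_mod ps) = odd n && all (fun p => ~~ (p %| n)%N) ps.
Proof.
have [_ hp] := hps.
rewrite coprimeMr (coprime_pexpr n 2 (isT : 0 < 3)%N) coprimen2; congr (_ && _).
rewrite coprime_prodr; apply: eq_in_all => p /hp /andP[pp _].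
by rewrite coprime_sym prime_coprime.
Qed.

Lemma qchar_tags_case t : t \in qchar_tags ps ->
  [\/ t = 4%N, t = 8%N | [/\ t \in ps, prime t & odd t]].
Proof.
have [_ hp] := hps; rewrite !inE => /or3P[/eqP|/eqP|tp]; [by constructor 1|by constructor 2|].
by constructor 3; have /andP[] := hp _ tp.
Qed.

(** Restricting every tag to integers prime to one common modulus makes them all characters of that
    modulus. *)
Definition qcharc (t n : nat) : int := (coprime n (qchar_mod ps))%:R * qchar t n.

Lemma qcharc_real t : t \in qchar_tags ps -> real_char (qchar_mod ps) (qcharc t).
Proof.
move=> /qchar_tags_case ht; split=> [n|m n|n cn|n cn].
- rewrite /qcharc /coprime ![gcdn _ (qchar_mod ps)]gcdnC gcdnDr; congr (_ * _).
  have m8 : ((n + qchar_mod ps) %% 8 = n %% 8)%N.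
    by rewrite /qchar_mod mulnC addnC modnMDl.
  case: ht => [->|->|[tp pt ot]]; last rewrite !qchar_prime //.
  - by rewrite /qchar /= modn8_4 m8 -modn8_4.
  - by rewrite /qchar /= m8.
  apply: leg_mod => //; rewrite PoszD addrAC subrr add0r.
  by rewrite dvdzE /= /qchar_mod dvdn_mull // (big_rem t) //= dvdn_mulr.
- rewrite /qcharc coprimeMl; case: (boolP (coprime m _)) => cm; last by rewrite !mul0r.
  case: (boolP (coprime n _)) => cn; last by rewrite !mul0r mulr0.
  rewrite !mul1r; move: cm cn; rewrite !coprime_qchar_mod => /andP[om _] /andP[on _].
  case: ht => [->|->|[tp pt ot]]; [exact: qchar4M|exact: qchar8M|].
  by rewrite !qchar_prime // PoszM legM.
- rewrite /qcharc cn mul1r; case: ht => [->|->|[tp pt ot]].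
  + by rewrite /qchar /=; case: ifP; [left|right].
  + by rewrite /qchar /=; case: ifP; [left|right].
  rewrite qchar_prime //; apply: leg_pm1 => //; rewrite dvdzE /=.
  by move: cn; rewrite coprime_qchar_mod => /andP[_ /allP]; apply.
- by rewrite /qcharc (negbTE cn) mul0r.
Qed.

Lemma qchar_congr t m u v : t \in qchar_tags ps -> (t \in ps -> t %| m)%N ->
  (t \notin ps -> 8 %| m)%N -> u = v %[mod m] -> qchar t u = qchar t v.
Proof.
have [_ hp] := hps => /qchar_tags_case ht h1 h2 uv.
have nps (s : nat) : ~~ prime s -> s \notin ps.
  by move=> ns; apply: contra ns => /hp /andP[].
have md d : (d %| m)%N -> u = v %[mod d].
  by move=> dm; rewrite -(modn_dvdm u dm) uv modn_dvdm.
case: ht => [e|e|[tp pt ot]].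
- by rewrite e /qchar /= (modn8_4 u) (modn8_4 v) md // h2 // e nps.
- by rewrite e /qchar /= md // h2 // e nps.
rewrite !qchar_prime //; apply: leg_mod => //.
by rewrite -eqz_mod_dvd !modz_nat eqz_nat md // h1.
Qed.

Lemma qchar1 t : t \in qchar_tags ps -> qchar t 1 = 1.
Proof.
by case/qchar_tags_case => [->|->|[_ pt ot]] //; rewrite qchar_prime // leg1.
Qed.

(** By the Chinese remainder theorem: u is a non-residue modulo a tag in [ps], or a suitable class
    modulo 8 for the tags 4 and 8, and is trivial for all other tags. *)
Lemma qchar_indep t : t \in qchar_tags ps ->
  exists u, [/\ coprime u (qchar_mod ps), qcharc t u = -1 &
    {in qchar_tags ps, forall s, s != t -> qcharc s u = 1}].
Proof.
have [ups hp] := hps => ht.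
suff [u cu [tu su]] : exists2 u, coprime u (qchar_mod ps) &
    qchar t u = -1 /\ {in qchar_tags ps, forall s, s != t -> qchar s u = 1}.
  by exists u; rewrite /qcharc cu mul1r; split=> // s hs st; rewrite mul1r su.
have nps (s : nat) : ~~ prime s -> s \notin ps.
  by move=> ns; apply: contra ns => /hp /andP[].
have [tp|ntp] := boolP (t \in ps).
  have /andP[pt ot] := hp _ tp; have [b hb] := leg_nonres pt ot.
  pose P := (8 * \prod_(p <- rem t ps) p)%N.
  have cP : coprime t P.
    rewrite coprimeMr (coprime_pexpr t 2 (isT : 0 < 3)%N) coprimen2 ot coprime_prodr.
    apply/allP => p; rewrite mem_rem_uniq // !inE => /andP[npt /hp /andP[pp _]].
    by rewrite prime_coprime // dvdn_prime2 // eq_sym.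
  pose u := chinese t P b 1.
  have u1 : u = 1 %[mod P] by apply: chinese_modr.
  have ub : u = b %[mod t] by apply: chinese_modl.
  have lu : legendre t u = -1.
    by rewrite -hb; apply: leg_mod => //; rewrite -eqz_mod_dvd !modz_nat eqz_nat ub.
  have cuP : coprime u P by rewrite -coprime_modl u1 coprime_modl coprime1n.
  exists u.
    have -> : qchar_mod ps = (t * P)%N by rewrite /qchar_mod /P (big_rem t) //= mulnCA.
    rewrite coprimeMr cuP andbT coprime_sym prime_coprime //.
    apply/negP => tu; have := leg_eq0 u pt ot; rewrite lu dvdzE /= tu //.
  split; first by rewrite qchar_prime.
  move=> s hs st; rewrite (@qchar_congr s P u 1%N) ?qchar1 //.
    move=> sp; rewrite /P dvdn_mull // (big_rem s) ?dvdn_mulr //.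
    by rewrite mem_rem_uniq // !inE st.
  by move=> _; rewrite /P dvdn_mulr.
pose P := (\prod_(p <- ps) p)%N; have cP : coprime 8 P.
  rewrite (coprime_pexpl 2 P (isT : 0 < 3)%N) coprime2n /P.
  have : coprime 2 P by rewrite coprime_prodr; apply/allP => p /hp /andP[_ op]; rewrite coprime2n.
  by rewrite coprime2n.
(* The class 7 modulo 8 has (-1/7) = -1 and (2/7) = 1; the class 5 has (-1/5) = 1 and (2/5) = -1. *)
pose u := chinese 8 P (if t == 4%N then 7 else 5) 1.
have u1 : u = 1 %[mod P] by apply: chinese_modr.
have u8 : (u %% 8 = if t == 4%N then 7 else 5)%N.
  by rewrite chinese_modl //; case: ifP.
exists u.
  rewrite coprimeMr (coprime_pexpr u 2 (isT : 0 < 3)%N) coprimen2.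
  rewrite -(coprime_modl u P) u1 coprime_modl coprime1n andbT.
  by rewrite (divn_eq u 8) oddD oddM andbF u8; case: ifP.
case/qchar_tags_case: ht => [et|et|[tp]]; last by rewrite tp in ntp.
  split; first by rewrite et /qchar /= modn8_4 u8 et.
  move=> s hs st; case/qchar_tags_case: (hs) => [e|->|[sp ps' os]]; first by rewrite e et in st.
    by rewrite /qchar /= u8 et.
  rewrite (@qchar_congr s P u 1%N) ?qchar1 ?sp // => _; by rewrite /P (big_rem s) //= dvdn_mulr.
split; first by rewrite et /qchar /= u8 et.
move=> s hs st; case/qchar_tags_case: (hs) => [->|e|[sp ps' os]]; last 2 first.
- by rewrite e et in st.
- rewrite (@qchar_congr s P u 1%N) ?qchar1 ?sp // => _; by rewrite /P (big_rem s) //= dvdn_mulr.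
by rewrite /qchar /= modn8_4 u8 et.
Qed.

Lemma prod_seq_sub (s : seq nat) (P : pred nat) (F : nat -> int) : uniq s ->
  \prod_(i : seq_sub s | P (ssval i)) F (ssval i) = \prod_(x <- s | P x) F x.
Proof.
move=> us; rewrite -(big_map (@ssval _ s) P F); apply: perm_big.
apply: uniq_perm => //; first by rewrite map_inj_uniq ?index_enum_uniq //; apply: val_inj.
move=> x; apply/mapP/idP => [[i _ ->]|xs]; first exact: valP.
by exists (SeqSub xs); rewrite ?mem_index_enum.
Qed.

(** [T] selects the tags whose product is the character of the divisor sum; values are prescribed at
    all tags, selected or not. *)
Lemma exists_qchar (T : pred nat) (eps : nat -> int) : has T (qchar_tags ps) ->
  {in qchar_tags ps, forall t, eps t = 1 \/ eps t = -1} ->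
  \prod_(t <- qchar_tags ps | T t) eps t = 1 ->
  exists c, [/\ (0 < c)%N, coprime c (qchar_mod ps),
    {in qchar_tags ps, forall t, qchar t c = eps t},
    forall q, prime q -> ~~ (q * q %| c)%N &
    forall q, prime q -> (q %| c)%N -> \prod_(t <- qchar_tags ps | T t) qchar t q = 1].
Proof.
have [ups hp] := hps => /hasP[t0 ht0 Tt0] e1 eT.
have nps (s : nat) : ~~ prime s -> s \notin ps.
  by move=> ns; apply: contra ns => /hp /andP[].
have us : uniq (qchar_tags ps) by rewrite /= !inE !negb_or !nps.
pose I := seq_sub (qchar_tags ps); pose psi (i : I) := qcharc (ssval i).
pose J : {set I} := [set i | T (ssval i)].
have J0 : J != set0 by apply/set0Pn; exists (SeqSub ht0); rewrite inE.
have cpsi (i : I) : real_char (qchar_mod ps) (psi i) by apply: qcharc_real; apply: valP.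
have ind (i : I) : exists u, [/\ coprime u (qchar_mod ps), psi i u = -1 &
    forall j, j != i -> psi j u = 1].
  have [u [cu ui uj]] := qchar_indep (valP i); exists u; split=> // j ji.
  by apply: uj; [exact: valP|].
have [||c [c0 cc ec sq hq]] := @exists_split_squarefree I _ psi qchar_mod_gt0
  cpsi ind J (fun i => eps (ssval i)) J0.
- by move=> i; apply: e1; apply: valP.
- by under eq_bigl do rewrite inE; rewrite (prod_seq_sub T eps us).
exists c; split=> // [t ht|q pq qc].
  by have := ec (SeqSub ht); rewrite /psi /qcharc cc mul1r.
apply: (etrans _ (hq q pq qc)); under [in RHS]eq_bigl do rewrite inE.
have cq : coprime q (qchar_mod ps) by move: cc; apply: coprime_dvdl.
rewrite -[LHS](prod_seq_sub T (fun t => qchar t q) us).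
by apply: eq_bigr => i _; rewrite /psi /qcharc cq mul1r.
Qed.

End QChar.

Lemma leg_N1_qchar p : prime p -> odd p -> legendre p (-1) = qchar 4 p.
Proof.
move=> pp op; rewrite leg_N1 // -signr_odd /qchar /= modn8_4.
have hp := odd_half_pred op; move: (p.-1./2) hp => h ->.
rewrite (divn_eq h 4); have := @ltn_pmod h 4 isT; move: (h %/ 4)%N (h %% 4)%N => j r.
rewrite oddD oddM andbF (_ : (j * 4 + r).*2.+1 = j * 8 + r.*2.+1)%N; last by lia.
by rewrite modnMDl; case: r => [|[|[|[|]]]].
Qed.

Lemma leg_2_qchar p : prime p -> odd p -> legendre p 2 = qchar 8 p.
Proof. exact: leg_2. Qed.

Lemma quad_recip_qchar p q : prime p -> odd p -> prime q -> odd q -> p != q ->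
  legendre q p = legendre p q * (if (p %% 4 == 3)%N then qchar 4 q else 1).
Proof.
move=> pp op pq oq pnq; have := quad_recip pp op pq oq pnq.
have := leg_N1_qchar pp op; have := leg_N1_qchar pq oq; rewrite !leg_N1 //.
rewrite -(signr_odd _ (_ * _)) oddM -(signr_odd _ p.-1./2) -(signr_odd _ q.-1./2).
have pk : qchar 4 p = if (p %% 4 == 3)%N then -1 else 1.
  by rewrite /qchar /= !(modn8_4 p); case: (odd_mod8 op) => ->.
have n1 : ~~ (p %| q%:Z)%Z by rewrite dvdzE /= dvdn_prime2.
have n2 : ~~ (q %| p%:Z)%Z by rewrite dvdzE /= dvdn_prime2 // eq_sym.
rewrite pk => <-; case: ifP => _; case: (odd p.-1./2) => //= _;
case: (odd q.-1./2) => /=;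
case: (leg_pm1 pp op n1) => ->; case: (leg_pm1 pq oq n2) => -> //.
Qed.

Lemma qchar4_prod (l : seq nat) : {in l, forall p, odd p} ->
  odd (\prod_(p <- l) p)%N /\ qchar 4 (\prod_(p <- l) p)%N = \prod_(p <- l) qchar 4 p.
Proof.
elim: l => [|p l IH] hl; first by rewrite !big_nil.
have op : odd p by apply: hl; rewrite inE eqxx.
have [ol el] : odd (\prod_(p <- l) p)%N /\ qchar 4 (\prod_(p <- l) p)%N = \prod_(p <- l) qchar 4 p.
  by apply: IH => r rl; apply: hl; rewrite inE rl orbT.
by rewrite !big_cons oddM op ol qchar4M // el.
Qed.

Lemma qchar8_prod (l : seq nat) : {in l, forall p, odd p} ->
  qchar 8 (\prod_(p <- l) p)%N = \prod_(p <- l) qchar 8 p.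
Proof.
elim: l => [|p l IH] hl; first by rewrite !big_nil.
have op : odd p by apply: hl; rewrite inE eqxx.
have hl' : {in l, forall p, odd p} by move=> r rl; apply: hl; rewrite inE rl orbT.
by rewrite !big_cons qchar8M ?IH //; case: (qchar4_prod hl').
Qed.

Lemma leg_prod (q : nat) (l : seq nat) : prime q -> odd q ->
  legendre q (\prod_(p <- l) p)%N = \prod_(p <- l) legendre q p.
Proof.
move=> pq oq; elim: l => [|p l IH]; first by rewrite !big_nil leg1.
by rewrite !big_cons PoszM legM // IH.
Qed.

(** Reciprocity in Jacobi's form: each prime that is 3 mod 4 contributes [qchar 4 q] and pairs of
    them cancel, so only the product modulo 4 matters. *)
Lemma quad_recip_prod q (l : seq nat) : prime q -> odd q ->
  {in l, forall p, [&& prime p, odd p & p != q]} ->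
  legendre q (\prod_(p <- l) p)%N =
    (if ((\prod_(p <- l) p) %% 4 == 3)%N then qchar 4 q else 1) * \prod_(p <- l) legendre p q.
Proof.
move=> pq oq; elim: l => [|p l IH] hl; first by rewrite !big_nil leg1.
have /and3P[pp op pnq] : [&& prime p, odd p & p != q] by apply: hl; rewrite inE eqxx.
have hl' : {in l, forall p, [&& prime p, odd p & p != q]}.
  by move=> r rl; apply: hl; rewrite inE rl orbT.
have ol : {in l, forall p, odd p} by move=> r /hl' /and3P[].
have [oP _] := qchar4_prod ol.
rewrite !big_cons PoszM legM // IH // quad_recip_qchar // -modnMm !(modn8_4 p) !(modn8_4 (\prod_(_ <- _) _)).
have k4 : qchar 4 q * qchar 4 q = 1 by rewrite /qchar /=; case: ifP.
case: (odd_mod8 op) => ->; case: (odd_mod8 oP) => -> /=; rewrite ?mul1r ?mulr1 //; try ring.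
all: by rewrite mulrACA -[RHS]mulr1 -k4; ring.
Qed.

(** * Squarefree integers *)

Definition sqfree (n : nat) := (0 < n)%N /\ forall q, prime q -> ~~ (q * q %| n)%N.

Lemma sqfreeM m n : sqfree (m * n) -> sqfree m /\ sqfree n.
Proof.
move=> [h0 h]; move: h0; rewrite muln_gt0 => /andP[m0 n0].
split; split=> // q pq; apply: contra (h q pq); [exact: dvdn_mulr|exact: dvdn_mull].
Qed.

Lemma sqfree_prod_primes n : sqfree n -> n = (\prod_(p <- primes n) p)%N.
Proof.
move=> [n0 h]; rewrite [LHS](prod_prime_decomp n0) prime_decompE big_map.
apply: eq_big_seq => p; rewrite mem_primes => /and3P[pp _ pn] /=.
suff -> : logn p n = 1%N by rewrite expn1.
have l1 : (0 < logn p n)%N by rewrite logn_gt0 mem_primes pp n0 pn.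
have := h p pp; rewrite mulnn pfactor_dvdn //; lia.
Qed.

(** Split off one prime at a time and glue by the Chinese remainder theorem; squarefreeness makes
    the two factors coprime. *)
Lemma sqfree_solve (n : nat) (al be : int) : sqfree n ->
  (forall p, prime p -> (p %| n)%N -> exists x : int, (p %| al * x ^+ 2 + be)%Z) ->
  exists x : int, (n %| al * x ^+ 2 + be)%Z.
Proof.
elim/ltn_ind: n => n IH sn h; have [n0 sq] := sn.
have [->|n1] := eqVneq n 1%N; first by exists 0; apply: dvd1z.
have n2 : (1 < n)%N by lia.
have pp := pdiv_prime n2; have pn := pdiv_dvd n; set p := pdiv n in pp pn.
move/dvdnP: (pn) => [m e].
have p1 := prime_gt1 pp.
have m0 : (0 < m)%N by move: n0; rewrite e muln_gt0 => /andP[].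
have cpm : coprime p m.
  by rewrite prime_coprime //; apply: contra (sq p pp) => /dvdnP[k ek]; rewrite e ek -mulnA dvdn_mull.
have sm : sqfree m by move: sn; rewrite {1}e => /sqfreeM[].
have [x hx] : exists x : int, (m %| al * x ^+ 2 + be)%Z.
  apply: IH => //; first by rewrite e ltn_Pmulr.
  by move=> q pq qm; apply: h => //; rewrite e dvdn_mulr.
have [y hy] := h p pp pn.
have cz : coprimez p m by rewrite coprimezE.
exists (zchinese p m y x); rewrite e PoszM Gauss_dvdz; last by rewrite coprimez_sym.
have cg (d : nat) (u v : int) : (u = v %[mod d])%Z -> (d %| al * v ^+ 2 + be)%Z ->
    (d %| al * u ^+ 2 + be)%Z.
  move=> /eqP; rewrite eqz_mod_dvd => /dvdzP[k ek] /dvdzP[l el].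
  apply/dvdzP; exists (l + al * k * (u + v)).
  have -> : al * u ^+ 2 + be = (al * v ^+ 2 + be) + al * (u - v) * (u + v) by ring.
  by rewrite ek el; ring.
by apply/andP; split; [apply: cg hx; apply: zchinese_modr|apply: cg hy; apply: zchinese_modl].
Qed.

(** * Reduction of ternary forms *)

(* The form with Gram matrix [ta tf te; tf tb td; te td tc]. *)
Record tern := Tern { ta : int; tb : int; tc : int; td : int; te : int; tf : int }.

Definition tbil (g : tern) (v w : int * int * int) : int :=
  let: (x, y, z) := v in let: (x', y', z') := w in
  ta g * x * x' + tb g * y * y' + tc g * z * z' + td g * (y * z' + y' * z) +
  te g * (x * z' + x' * z) + tf g * (x * y' + x' * y).

Definition tminor g v w := tbil g v v * tbil g w w - tbil g v w ^+ 2.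

(* tA, tB, tC are the coefficients of the binary form obtained by projecting ta * g
   along the first basis vector. *)
Definition tA g := ta g * tb g - tf g ^+ 2.
Definition tB g := ta g * td g - te g * tf g.
Definition tC g := ta g * tc g - te g ^+ 2.

Definition tdet g := ta g * tb g * tc g + 2 * td g * te g * tf g
  - ta g * td g ^+ 2 - tb g * te g ^+ 2 - tc g * tf g ^+ 2.

(* The last clause excludes the class of 1 + [2 1; 1 (D+1)/2]: for that form, twice
   any 2x2 minor is a square modulo D. *)
Definition in_class (D N : int) (g : tern) : Prop :=
  [/\ 0 < ta g, 0 < tA g, tdet g = D, exists v, tbil g v v = N &
      exists v w, forall u, ~ (D %| 2 * tminor g v w - u ^+ 2)%Z].

Lemma tdet_schur g : tA g * tC g - tB g ^+ 2 = ta g * tdet g.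
Proof. rewrite /tA /tB /tC /tdet; ring. Qed.

Lemma in_class_map D N g h (phi : int * int * int -> int * int * int) :
  0 < ta h -> 0 < tA h -> tdet h = tdet g ->
  (forall v w, tbil h (phi v) (phi w) = tbil g v w) ->
  in_class D N g -> in_class D N h.
Proof.
move=> ha hA hd hphi [ga gA gd [v gv] [w [w' gw]]]; split=> //; first by rewrite hd.
  by exists (phi v); rewrite hphi.
by exists (phi w), (phi w') => u; rewrite /tminor !hphi; apply: gw.
Qed.

Definition shift12 k g := Tern (ta g) (tb g + 2 * k * tf g + k ^+ 2 * ta g) (tc g)
  (td g + k * te g) (te g) (tf g + k * ta g).
Definition shift23 k g := Tern (ta g) (tb g) (tc g + 2 * k * td g + k ^+ 2 * tb g)
  (td g + k * tb g) (te g + k * tf g) (tf g).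
Definition shift13 k g := Tern (ta g) (tb g) (tc g + 2 * k * te g + k ^+ 2 * ta g)
  (td g + k * tf g) (te g + k * ta g) (tf g).
Definition swap12 g := Tern (tb g) (ta g) (tc g) (te g) (td g) (tf g).
Definition swap23 g := Tern (ta g) (tc g) (tb g) (td g) (tf g) (te g).

Ltac tern_ring := rewrite /tA /tB /tC /tdet /=; ring.

Lemma in_class_shift12 D N k g : in_class D N g -> in_class D N (shift12 k g).
Proof.
move=> hg; have [a0 A0 _ _ _] := hg.
apply: (in_class_map (phi := fun v => (v.1.1 - k * v.1.2, v.1.2, v.2))) hg => //.
- by rewrite (_ : tA _ = tA g) //; tern_ring.
- tern_ring.
by move=> [[x y] z] [[x' y'] z'] /=; ring.
Qed.

Lemma in_class_shift23 D N k g : in_class D N g -> in_class D N (shift23 k g).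
Proof.
move=> hg; have [a0 A0 _ _ _] := hg.
apply: (in_class_map (phi := fun v => (v.1.1, v.1.2 - k * v.2, v.2))) hg => //.
- tern_ring.
by move=> [[x y] z] [[x' y'] z'] /=; ring.
Qed.

Lemma in_class_shift13 D N k g : in_class D N g -> in_class D N (shift13 k g).
Proof.
move=> hg; have [a0 A0 _ _ _] := hg.
apply: (in_class_map (phi := fun v => (v.1.1 - k * v.2, v.1.2, v.2))) hg => //.
- tern_ring.
by move=> [[x y] z] [[x' y'] z'] /=; ring.
Qed.

Lemma in_class_swap12 D N g : in_class D N g -> in_class D N (swap12 g).
Proof.
move=> hg; have [a0 A0 _ _ _] := hg.
apply: (in_class_map (phi := fun v => (v.1.2, v.1.1, v.2))) hg => //.
- by move: a0 A0; rewrite /tA /=; nia.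
- by rewrite (_ : tA _ = tA g) //; tern_ring.
- tern_ring.
by move=> [[x y] z] [[x' y'] z'] /=; ring.
Qed.

Lemma in_class_swap23 D N g : 0 < D -> in_class D N g -> in_class D N (swap23 g).
Proof.
move=> D0 hg; have [a0 A0 dD _ _] := hg.
apply: (in_class_map (phi := fun v => (v.1.1, v.2, v.1.2))) hg => //.
- have := tdet_schur g; rewrite dD (_ : tA (swap23 g) = tC g) //; nia.
- tern_ring.
by move=> [[x y] z] [[x' y'] z'] /=; ring.
Qed.

Lemma centered_mod (a f : int) : 0 < a -> exists k, - a <= 2 * (f + k * a) <= a.
Proof.
move=> a0; exists (- ((2 * f + a) %/ (2 * a))%Z).
have := divz_eq (2 * f + a) (2 * a).
have := ltz_pmod (2 * f + a) (_ : 0 < 2 * a); have := modz_ge0 (2 * f + a) (_ : 2 * a != 0).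
move: (_ %/ _)%Z (_ %% _)%Z => q r h1 h2 e.
have {}h1 : 0 <= r by apply: h1; lia.
have {}h2 : r < 2 * a by apply: h2; lia.
nia.
Qed.

Definition reduced g := [/\ ta g <= tb g, - ta g <= 2 * tf g <= ta g,
  - ta g <= 2 * te g <= ta g, - tA g <= 2 * tB g <= tA g & tA g <= tC g].

(** Lexicographic descent on ([ta], [tA]), both positive: exchanging the first two vectors lowers
    [ta]; exchanging the last two keeps [ta] and replaces [tA] by a smaller [tC]. *)
Lemma reduction D N g : 0 < D -> in_class D N g ->
  exists2 h, in_class D N h & reduced h.
Proof.
move=> D0; move: {-1}`|ta g|%N (erefl `|ta g|%N) => n; elim/ltn_ind: n g => n IHn g.
move: {-1}`|tA g|%N (erefl `|tA g|%N) => m; elim/ltn_ind: m g => m IHm g em en hg.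
have [a0 A0 _ _ _] := hg.
have [k1 hk1] := centered_mod (tB g) A0.
(* The order matters: the last two shifts preserve [tA] and [tB], and [shift13] preserves [tf], so
   each normalization survives the later ones. *)
pose g1 := shift23 k1 g.
have [k2 hk2] := centered_mod (tf g1) (a0 : 0 < ta g1).
pose g2 := shift12 k2 g1.
have [k3 hk3] := centered_mod (te g2) (a0 : 0 < ta g2).
pose g3 := shift13 k3 g2.
have c3 : in_class D N g3.
  by apply: in_class_shift13; apply: in_class_shift12; apply: in_class_shift23.
have eA : tA g3 = tA g by tern_ring.
have eB : tB g3 = tB g + k1 * tA g by tern_ring.
have [ba|ab] := ltP (tb g3) (ta g3).
  have c4 := in_class_swap12 c3; have [b0 _ _ _ _] := c4.
  apply: (IHn _ _ _ (erefl _) c4); rewrite -en.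
  change (is_true (0 < tb g3)) in b0; change (is_true (tb g3 < ta g)) in ba.
  by change (is_true (`|tb g3| < `|ta g|)%N); move: (tb g3) b0 ba => b; lia.
have [CA|AC] := ltP (tC g3) (tA g3).
  have c4 := in_class_swap23 D0 c3; have [_ b0 _ _ _] := c4.
  apply: (IHm _ _ _ (erefl _) _ c4) => //.
  change (is_true (0 < tC g3)) in b0; rewrite eA in CA; rewrite -em.
  by change (is_true (`|tC g3| < `|tA g|)%N); move: (tC g3) b0 CA => b; lia.
by exists g3 => //; split=> //; rewrite eA eB.
Qed.

(** Hermite's argument: binary reduction gives 3 ta^2 <= 4 tA in the first two variables, and 3 tA^2
    <= 4 ta tdet for the projected form, whose determinant is ta tdet. Eliminating tA gives the
    second bound. *)
Lemma reduced_bound g : 0 < ta g -> 0 < tA g -> reduced g ->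
  3 * tA g ^+ 2 <= 4 * ta g * tdet g /\ 27 * ta g ^+ 3 <= 64 * tdet g.
Proof.
move=> a0 A0 [ab hf _ hB AC]; have := tdet_schur g.
have h1 : 3 * ta g ^+ 2 <= 4 * tA g by rewrite /tA; nia.
move: (tdet g) => D e.
have h2 : 3 * tA g ^+ 2 <= 4 * ta g * D by nia.
split=> //.
suff : ta g * (27 * ta g ^+ 3) <= ta g * (64 * D) by rewrite ler_pM2l.
have h3 : 9 * ta g ^+ 4 <= 16 * tA g ^+ 2.
  have -> : 9 * ta g ^+ 4 = (3 * ta g ^+ 2) ^+ 2 by ring.
  have -> : 16 * tA g ^+ 2 = (4 * tA g) ^+ 2 by ring.
  by rewrite ler_sqr ?nnegrE //; nia.
by rewrite (_ : ta g * (27 * ta g ^+ 3) = 3 * (9 * ta g ^+ 4)); [lia|ring].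
Qed.

(** The bounds leave ta = 1, so the form is x^2 plus a reduced binary form of determinant D with tb
    <= 2. For tb = 1 it is diag(1,1,D); tb = 2 is the class that [in_class] excludes. *)
Lemma ternary_class (D N : int) g : D = 3 \/ D = 5 -> in_class D N g ->
  exists x y z : int, N = x ^+ 2 + y ^+ 2 + D * z ^+ 2.
Proof.
move=> hD hg; have D0 : 0 < D by lia.
have [h [a0 A0 dD [[[x y] z] hv] [[[x1 y1] z1] [[[x2 y2] z2] hw]]] rh] := reduction D0 hg.
have [b1 b2] := reduced_bound a0 A0 rh; have [ab hf he hB AC] := rh.
have s := tdet_schur h; rewrite dD in s b1 b2.
have a2 : ta h <= 2 by case: hD b2 => ->; nia.
have a1 : ta h = 1.
  suff : ta h != 2 by lia.
  (* The value 2 survives the bound only for D = 5; then tA = 3 and 3 tC = tB^2 + 10 with tB^2 <= 1,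
     impossible modulo 3. *)
  apply/eqP => a2e; case: hD => De; first by move: b2; rewrite a2e De.
  have A3 : tA h <= 3 by rewrite De a2e in b1; nia.
  have A3' : tA h = 3 by move: A3; rewrite /tA a2e in ab hf *; nia.
  have hB1 : tB h ^+ 2 <= 1 by rewrite A3' in hB; nia.
  by move: s; rewrite A3' a2e De; have := sqr_ge0 (tB h); lia.
have f0 : tf h = 0 by rewrite a1 in hf; lia.
have e0 : te h = 0 by rewrite a1 in he; lia.
have eA : tA h = tb h by rewrite /tA a1 f0; lia.
have eB : tB h = td h by rewrite /tB a1 f0; lia.
have eC : tC h = tc h by rewrite /tC a1 e0; lia.
rewrite eA eB eC a1 in s b1 hB AC A0.
have b2' : tb h <= 2 by nia.
case: h a1 f0 e0 hv hw s b2' A0 hB {b1 b2 ab hf he AC rh eA eB eC a2 dD a0} => a b c d e f /=.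
move=> -> -> -> hv hw s b2 b0 hB.
have [eb|eb] : b = 1 \/ b = 2 by lia.
  have d0 : d = 0 by lia.
  have cD : c = D by rewrite eb d0 in s; lia.
  by exists x, y, z; rewrite -hv eb d0 cD; ring.
exfalso; have d1 : d ^+ 2 = 1.
  have : d != 0 by apply/eqP => d0; rewrite d0 eb in s; lia.
  by move=> dn; have [->|->] : d = 1 \/ d = -1 by lia.
(* Modulo D the form is x^2 + l^2 / 2 with l = 2 y + d z, so twice a minor is the square of x1 l2 -
   x2 l1. *)
apply: (hw (x1 * (2 * y2 + d * z2) - x2 * (2 * y1 + d * z1))).
apply/dvdzP; exists ((x1 * z2 - x2 * z1) ^+ 2 + 2 * (y1 * z2 - y2 * z1) ^+ 2).
have De : D = 2 * c - d ^+ 2 by rewrite eb in s; lia.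
rewrite De eb /tminor /=.
ring.
Qed.

(** [u4] and [u8] tell whether (-1/.) and (2/.) enter the product character chi, which is 1 at every
    prime factor of c; the symbols at [ps] always enter. The product hypothesis says chi(c) = 1. *)
Lemma exists_prescribed_symbols ps (u4 u8 : bool) (s4 s8 : int) (e : nat -> int) :
  odd_primes ps -> [|| u4, u8 | ps != [::]] -> (s4 = 1 \/ s4 = -1) -> (s8 = 1 \/ s8 = -1) ->
  {in ps, forall p, e p = 1 \/ e p = -1} ->
  (if u4 then s4 else 1) * (if u8 then s8 else 1) * \prod_(p <- ps) e p = 1 ->
  exists c, [/\ sqfree c, odd c, {in ps, forall p, ~~ (p %| c)%N},
    [/\ qchar 4 c = s4, qchar 8 c = s8 & {in ps, forall p, legendre p c = e p}] &
    forall q, prime q -> (q %| c)%N ->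
      (if u4 then qchar 4 q else 1) * (if u8 then qchar 8 q else 1) * \prod_(p <- ps) legendre p q = 1].
Proof.
move=> hps hne hs4 hs8 he hprod; have [ups hp] := hps.
pose T t := if t == 4%N then u4 else if t == 8%N then u8 else true.
pose eps t := if t == 4%N then s4 else if t == 8%N then s8 else e t.
have np p : p \in ps -> (p == 4%N) = false /\ (p == 8%N) = false.
  move=> /hp /andP[pp op]; have /andP[/negbTE-> /negbTE->//] := odd_prime_tag pp op.
have prodT (F : nat -> int) : \prod_(t <- qchar_tags ps | T t) F t =
    (if u4 then F 4%N else 1) * (if u8 then F 8%N else 1) * \prod_(p <- ps) F p.
  rewrite /qchar_tags !big_cons /T /= -/T.
  have -> : \prod_(p <- ps | T p) F p = \prod_(p <- ps) F p.
    rewrite big_seq_cond [RHS]big_seq; apply: eq_bigl => p.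
    by case: (boolP (p \in ps)) => //= /np[h4 h8]; rewrite /T h4 h8.
  by case: (u4); case: (u8); rewrite ?(mul1r, mulr1, mulrA).
have [|||c [c0 cc ec sq hq]] := @exists_qchar ps hps T eps.
- case/or3P: hne => [h|h|]; rewrite /qchar_tags /= /T /= ?h ?orbT //.
  case: (ps) np => // p s np _; rewrite /= ; have [-> ->] := np p (mem_head _ _).
  by rewrite !orbT.
- move=> t; rewrite /qchar_tags !inE => /or3P[/eqP->|/eqP->|tp]; rewrite /eps //=.
  by have [-> ->] := np _ tp; apply: he.
- rewrite prodT /eps /=; rewrite -[RHS]hprod; congr (_ * _).
  by apply: eq_big_seq => p /np[-> ->].
have legE' p n : p \in ps -> qchar p n = legendre p n.
  by move=> pp; rewrite /qchar; have [-> ->] := np _ pp.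
move: cc; rewrite (coprime_qchar_mod hps) => /andP[oc /allP pc].
exists c; split=> //.
  split; [by rewrite ec // inE eqxx|by rewrite ec // !inE eqxx orbT|].
  move=> p pp; rewrite -legE' // ec; last by rewrite !inE pp !orbT.
  by rewrite /eps; have [-> ->] := np _ pp.
move=> q pq qc; rewrite -[RHS](hq q pq qc) prodT; congr (_ * _).
by apply: eq_big_seq => p pp; rewrite legE'.
Qed.

Lemma solve_linear (p : nat) (u x : int) : prime p -> ~~ (p %| u)%Z ->
  exists t : int, (p %| u * t - x)%Z.
Proof.
move=> pp pu; have [a [b e]] := Bezoutz p%:Z u.
have g1 : gcdz p%:Z u = 1.
  by apply/eqP; rewrite -/(coprimez _ _) coprimezE /= prime_coprime //; move: pu; rewrite dvdzE.
exists (b * x); apply/dvdzP; exists (- (a * x)).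
have -> : u * (b * x) - x = (a * p%:Z + b * u) * x - a * p%:Z * x - x by ring.
by rewrite e g1; ring.
Qed.

(** With De = a c - b^2, the matrix [a b t; b c 0; t 0 M] has determinant M De - c t^2. First t is
    chosen to make De integral, then b to make a integral. Taking k = 1 gives M = N and determinant
    d; k = 3 and d = 1, multiplied through by 3, give M = 3 N and determinant 3 with 3 t in place of
    t. *)
Lemma gram_congruences (N c : nat) (k d : int) : 0 < k -> 0 < d -> sqfree N -> sqfree c ->
  (forall p, prime p -> (p %| N)%N -> ~~ (p %| k * c%:Z)%Z) ->
  (forall q, prime q -> (q %| c)%N -> ~~ (q %| N)%N) ->
  (forall p, prime p -> (p %| N)%N -> exists x : int, (p %| x ^+ 2 + k * d * c%:Z)%Z) ->
  (forall q, prime q -> (q %| c)%N -> exists x : int, (q %| x ^+ 2 + d * N%:Z)%Z) ->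
  exists De t b a : int, [/\ 0 < De, 0 < a, N%:Z * De = k * c%:Z * t ^+ 2 + d &
    a * c%:Z = b ^+ 2 + De].
Proof.
move=> k0 d0 sN sc hkc hN h1 h2.
have [t ht] : exists t : int, (N %| k * c%:Z * t ^+ 2 + d)%Z.
  apply: sqfree_solve => // p pp pN; have [x hx] := h1 p pp pN.
  have [t ht] := solve_linear x pp (hkc p pp pN); exists t.
  have cp : coprimez p (k * c%:Z).
    by rewrite coprimezE /= prime_coprime //; move: (hkc p pp pN); rewrite dvdzE.
  rewrite -(Gauss_dvdzr _ cp).
  (* Multiplying by k c, which is prime to p, completes the square in t. *)
  have -> : k * c%:Z * (k * c%:Z * t ^+ 2 + d) =
    (k * c%:Z * t - x) * (k * c%:Z * t + x) + (x ^+ 2 + k * d * c%:Z) by ring.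
  by apply: rpredD => //; apply: dvdz_mulr.
have /dvdzP [De eDe] := ht.
have N0 : (0 < N)%N by case: sN.
have c0 : (0 < c)%N by case: sc.
have De0 : 0 < De.
  have : 0 < De * N%:Z by rewrite -eDe ltr_wpDl // mulr_ge0 ?sqr_ge0 // mulr_ge0 // ltW.
  by rewrite pmulr_lgt0.
have [b hb] : exists b : int, (c %| 1 * b ^+ 2 + De)%Z.
  apply: sqfree_solve => // q pq qc; have [x hx] := h2 q pq qc.
  have qN : ~~ (q %| N%:Z)%Z by rewrite dvdzE /=; apply: hN.
  have [b hb] := solve_linear x pq qN; exists b.
  have cq : coprimez q N by rewrite coprimezE /= prime_coprime //; apply: hN.
  (* Multiplying by N^2, prime to q, replaces De by N (k c t^2 + d), which is d N modulo c. *)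
  rewrite -(Gauss_dvdzr _ cq) -(Gauss_dvdzr _ cq).
  have -> : N%:Z * (N%:Z * (1 * b ^+ 2 + De)) =
    (N%:Z * b - x) * (N%:Z * b + x) + (x ^+ 2 + d * N%:Z) + N%:Z * k * t ^+ 2 * c%:Z.
    transitivity (N%:Z ^+ 2 * b ^+ 2 + N%:Z * (De * N%:Z)); first by ring.
    by rewrite -eDe; ring.
  apply: rpredD; last by apply: dvdz_mull; rewrite dvdzE.
  by apply: rpredD => //; apply: dvdz_mulr.
have /dvdzP [a ea] := hb; rewrite mul1r in ea.
exists De, t, b, a; split=> //; last by rewrite mulrC -eDe.
have : 0 < a * c%:Z by rewrite -ea ltr_wpDl // sqr_ge0.
by rewrite pmulr_lgt0.
Qed.

Lemma nonres_ndvd (D : nat) (x u : int) : prime D -> odd D -> legendre D x = -1 ->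
  ~ (D %| x - u ^+ 2)%Z.
Proof.
move=> pD oD lx h; have := leg_mod pD h; rewrite lx expr2 legM //.
by case: (leg_sgn3 D u) => ->.
Qed.

Lemma in_class_of_gram (D : nat) (M De t b a c : int) : prime D -> odd D ->
  0 < c -> 0 < De -> 0 < a ->
  M * De = c * t ^+ 2 + D%:Z -> a * c = b ^+ 2 + De ->
  legendre D (2 * (c * M)) = -1 \/ legendre D (2 * De) = -1 ->
  in_class D M (Tern a c M 0 t b).
Proof.
move=> pD oD c0 De0 a0 e1 e2 hl.
have eDe : De = a * c - b ^+ 2 by rewrite e2; ring.
split=> //.
- by rewrite /tA /= -eDe.
- rewrite /tdet /= (_ : D%:Z = M * De - c * t ^+ 2); [rewrite eDe; ring|rewrite e1; ring].
- by exists (0, 0, 1); rewrite /=; ring.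
case: hl => hl.
  exists (0, 1, 0), (0, 0, 1) => u; apply: nonres_ndvd => //; rewrite -hl; congr (legendre D _).
  by rewrite /tminor /=; ring.
exists (1, 0, 0), (0, 1, 0) => u; apply: nonres_ndvd => //; rewrite -hl; congr (legendre D _).
by rewrite /tminor /= eDe; ring.
Qed.

(** * Representations by ternary forms *)

Lemma qchar4_sqr n : qchar 4 n * qchar 4 n = 1.
Proof. by rewrite /qchar /=; case: ifP. Qed.

Lemma leg_2_3 : legendre 3 2 = -1. Proof. by rewrite leg_2. Qed.
Lemma leg_2_5 : legendre 5 2 = -1. Proof. by rewrite leg_2. Qed.

Lemma leg_3 p : prime p -> odd p -> p != 3%N -> legendre p 3 = legendre 3 p * qchar 4 p.
Proof. by move=> pp op p3; rewrite (@quad_recip_qchar 3 p) // eq_sym. Qed.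

Lemma leg_5 p : prime p -> odd p -> p != 5%N -> legendre p 5 = legendre 5 p.
Proof. by move=> pp op p5; rewrite (@quad_recip_qchar 5 p) ?mulr1 // eq_sym. Qed.

Lemma leg_N3 p : prime p -> odd p -> p != 3%N -> legendre p (- 3) = legendre 3 p.
Proof.
move=> pp op p3; have -> : legendre p (- 3) = legendre p (-1) * legendre p 3 by rewrite -legM.
rewrite leg_N1_qchar // leg_3 //.
by rewrite mulrCA qchar4_sqr mulr1.
Qed.

Lemma mem_primes_odd n p : odd n -> p \in primes n -> [&& prime p, odd p & (p %| n)%N].
Proof.
move=> on; rewrite mem_primes => /and3P[-> _ pn]; rewrite pn andbT /=.
exact: dvdn_odd pn on.
Qed.

Lemma leg_sqfree q n : prime q -> odd q -> odd n -> sqfree n -> ~~ (q %| n)%N ->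
  legendre q n = (if (n %% 4 == 3)%N then qchar 4 q else 1) * \prod_(p <- primes n) legendre p q.
Proof.
move=> pq oq on sn qn; rewrite {1 2}(sqfree_prod_primes sn) quad_recip_prod //.
move=> p /(mem_primes_odd on) /and3P[pp op pn]; rewrite pp op /=.
by apply: contra qn => /eqP <-.
Qed.

Lemma leg_sqfree_prod q n : prime q -> odd q -> sqfree n ->
  legendre q n = \prod_(p <- primes n) legendre q p.
Proof. by move=> pq oq sn; rewrite {1}(sqfree_prod_primes sn) leg_prod. Qed.

Lemma prod_leg_N3 n : odd n -> sqfree n -> ~~ (3 %| n)%N ->
  \prod_(p <- primes n) legendre p (- 3) = legendre 3 n.
Proof.
move=> on sn n3; rewrite leg_sqfree_prod //; apply: eq_big_seq => p.
move=> /(mem_primes_odd on) /and3P[pp op pn]; apply: leg_N3 => //.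
by apply: contra n3 => /eqP <-.
Qed.

Lemma leg_eq1_dvd (p : nat) (a : int) : prime p -> odd p -> legendre p (- a) = 1 ->
  exists x : int, (p %| x ^+ 2 + a)%Z.
Proof. by move=> pp op /(leg1_sq pp op)[x]; rewrite opprK; exists x. Qed.

Lemma leg_sgn p (a : int) : prime p -> odd p -> ~~ (p %| a)%Z -> legendre p a * legendre p a = 1.
Proof. by move=> pp op pa; case: (leg_pm1 pp op pa) => ->. Qed.

Lemma odd_primes_cons D n : prime D -> odd D -> odd n -> ~~ (D %| n)%N ->
  odd_primes (D :: primes n).
Proof.
move=> pD oD on Dn; split.
  by rewrite /= primes_uniq andbT mem_primes (negbTE Dn) !andbF.
move=> p; rewrite inE => /orP[/eqP->|/(mem_primes_odd on)/and3P[-> -> //]].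
by rewrite pD oD.
Qed.

Lemma prime_dvdn_pow2M p n (b : bool) : prime p -> (p %| 2 ^ b * n)%N -> (b /\ p = 2%N) \/ (p %| n)%N.
Proof.
move=> pp; rewrite Euclid_dvdM // => /orP[|]; last by right.
case: b => /=; last by rewrite expn0 Euclid_dvd1.
by rewrite expn1 dvdn_prime2 // => /eqP; left.
Qed.

(** By reciprocity the product character at q is (-3N/q), so -3N is a square modulo every prime
    factor of c. *)
Lemma repr_113_sqfree (n : nat) (b : bool) : odd n -> sqfree (2 ^ b * n) -> ~~ (3 %| n)%N ->
  exists x y z : int, (2 ^ b * n)%N = x ^+ 2 + y ^+ 2 + 3 * z ^+ 2 :> int.
Proof.
move=> on sN n3; set N := (2 ^ b * n)%N.
have [_ sn] := sqfreeM sN.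
have N3 : ~~ (3 %| N)%N by rewrite Euclid_dvdM // negb_or n3 andbT; case: (b).
have N3z : ~~ (3 %| N%:Z)%Z by rewrite dvdzE.
(* (c/p) = (-3/p) makes -3c a square modulo p, and (c/3) = (N/3) makes 2 c N a non-residue modulo 3.
   For even N, (2/c) = -1 offsets (2/3) = -1 in the compatibility condition. *)
pose e p := if p == 3%N then legendre 3 N else legendre p (- 3).
have [|||||c [sc oc pc [k4 k8 ec] hq]] := @exists_prescribed_symbols (3%N :: primes n) (n %% 4 == 3)%N b 1
   (if b then -1 else 1) e (odd_primes_cons (isT : prime 3) isT on n3).
- by rewrite !orbT.
- by left.
- by case: (b); [right|left].
- move=> p; rewrite inE /e; case: eqP => [_ _|p3 /= /(mem_primes_odd on) /and3P[pp op pn]].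
    exact: leg_pm1.
  apply: leg_pm1 => //; rewrite dvdzE /= dvdn_prime2 //; exact/eqP.
- rewrite big_cons {1}/e eqxx (eq_big_seq (fun p => legendre p (- 3))); last first.
    move=> p /(mem_primes_odd on) /and3P[pp op pn]; rewrite /e; case: eqP => // p3.
    by rewrite -p3 pn in n3.
  rewrite prod_leg_N3 // /N PoszM legM //.
  have n3z : ~~ (3 %| n%:Z)%Z by rewrite dvdzE.
  rewrite if_same mul1r -(mulrA (legendre 3 _)) (leg_sgn (isT : prime 3) isT n3z) mulr1.
  by case: (b); rewrite ?leg_2_3 ?leg1.
have c3 : ~~ (3 %| c)%N by apply: pc; rewrite inE eqxx.
have hpc p : prime p -> (p %| N)%N -> ~~ (p %| 1 * c%:Z)%Z.
  move=> pp /prime_dvdn_pow2M [//|[_ ->]|pn]; rewrite mul1r dvdzE /=; first by rewrite dvdn2 negbK.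
  by apply: pc; rewrite inE mem_primes pp pn (proj1 sn) orbT.
have hcN q : prime q -> (q %| c)%N -> ~~ (q %| N)%N.
  move=> pq qc; apply/negP => qN; have := hpc q pq qN; by rewrite mul1r dvdzE /= qc.
have [||De [t [bb [a [De0 a0 e1 e2]]]]] := @gram_congruences N c 1 3 isT isT sN sc hpc hcN.
- move=> p pp /prime_dvdn_pow2M [//|[_ ->]|pn].
    exists 1; rewrite mul1r dvdzE /=.
    by rewrite -[X in (2 %| X)%N]/(1 + 3 * c)%N dvdn2 oddD oddM oc.
  have pin : p \in primes n by rewrite mem_primes pp pn; case: sn => ->.
  have /and3P[_ op _] := mem_primes_odd on pin.
  rewrite mul1r; apply: leg_eq1_dvd => //.
  rewrite -mulNr legM // ec ?inE ?pin ?orbT //.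
  rewrite /e; case: eqP => [p3|/eqP p3]; first by rewrite -p3 pn in n3.
  apply: leg_sgn => //; rewrite dvdzE /= dvdn_prime2 //.
- move=> q pq qc; have oq := dvdn_odd qc oc.
  have q3 : q != 3%N by apply: contraNneq c3 => <-.
  have qN := hcN q pq qc.
  have qn : ~~ (q %| n)%N by apply: contra qN; apply: dvdn_mull.
  apply: leg_eq1_dvd => //; rewrite -mulNr legM // leg_N3 // /N PoszM legM //.
  rewrite (@leg_sqfree q n) //; apply: (etrans _ (hq q pq qc)); rewrite big_cons.
  have -> : legendre q (2 ^ b)%N = if b then qchar 8 q else 1.
    by case: (b) => /=; [apply: leg_2_qchar|apply: leg1].
  by ring.
apply: (@ternary_class 3 N%:Z) (@in_class_of_gram 3 N%:Z De t bb a c%:Z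
  isT isT _ De0 a0 _ e2 _); first by left.
- by case: sc => c0 _; lia.
- by rewrite e1 mul1r.
left; rewrite !legM // leg_2_3 ec ?inE ?eqxx // /e eqxx.
by rewrite leg_sgn.
Qed.

(** Here M = 3 N with N = 2 n, and the product character is (-2n/q). Modulo 3, N De = 1 and N = 1,
    so 2 De is a non-residue and the minor De fixes the class. *)
Lemma repr_133_sqfree (n : nat) : odd n -> sqfree n -> (n %% 3 = 2)%N ->
  exists x y z : int, 3 * (2 * n%:Z) = x ^+ 2 + y ^+ 2 + 3 * z ^+ 2.
Proof.
move=> on sn n32.
have n3 : ~~ (3 %| n)%N by rewrite /dvdn n32.
have l3n : legendre 3 n = -1.
  by rewrite -leg_2_3; apply: leg_mod => //; rewrite -eqz_mod_dvd !modz_nat n32.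
(* For n = 3 mod 4 the reciprocity sign of (n/q) cancels (-1/q), so (-1/.) enters only for n = 1 mod
   4. The value (2/c) = -1 matches (n/3) = -1. *)
have [||||||c [sc oc pc [k4 k8 ec] hq]] := @exists_prescribed_symbols (primes n) (n %% 4 == 1)%N true 1
   (-1) (fun p => legendre p (- 3)).
- split; first exact: primes_uniq.
  by move=> p /(mem_primes_odd on) /and3P[-> ->].
- by rewrite orbT.
- by left.
- by right.
- move=> p /(mem_primes_odd on) /and3P[pp op pn].
  apply: leg_pm1 => //; rewrite dvdzE /= dvdn_prime2 //.
  by apply: contra n3 => /eqP <-.
- by rewrite prod_leg_N3 // l3n if_same.
set N := (2 * n)%N.
have sN : sqfree N.
  have [n0 sq] := sn; split; first by rewrite muln_gt0.
  move=> q pq; have [->|q2] := eqVneq q 2%N; first by rewrite dvdn_pmul2l // dvdn2 negbK.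
  have c2 : coprime q 2 by rewrite prime_coprime // dvdn_prime2.
  by rewrite Gauss_dvdr ?sq // coprimeMl c2.
have hpc p : prime p -> (p %| N)%N -> ~~ (p %| 3 * c%:Z)%Z.
  move=> pp; rewrite Euclid_dvdM // => /orP[|pn].
    by rewrite dvdn_prime2 // => /eqP ->; rewrite dvdzE /= dvdn2 oddM oc.
  rewrite dvdzE /= Euclid_dvdM // negb_or dvdn_prime2 // pc ?andbT; last first.
    by rewrite mem_primes pp pn (proj1 sn).
  by apply: contra n3 => /eqP p3; have -> : 3%N = p by rewrite p3.
have hcN q : prime q -> (q %| c)%N -> ~~ (q %| N)%N.
  move=> pq qc; apply/negP => qN; have := hpc q pq qN.
  by rewrite dvdz_mull // dvdzE.
have [||De [t [bb [a [De0 a0 e1 e2]]]]] := @gram_congruences N c 3 1 isT isT sN sc hpc hcN.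
- move=> p pp; rewrite Euclid_dvdM // => /orP[|pn].
    rewrite dvdn_prime2 // => /eqP ->; exists 1; rewrite mulr1 dvdzE /=.
    by rewrite -[X in (2 %| X)%N]/(1 + 3 * c)%N dvdn2 oddD oddM oc.
  have pin : p \in primes n by rewrite mem_primes pp pn (proj1 sn).
  have /and3P[_ op _] := mem_primes_odd on pin.
  rewrite mulr1; apply: leg_eq1_dvd => //.
  rewrite -mulNr legM // ec //.
  apply: leg_sgn => //; rewrite dvdzE /= dvdn_prime2 //.
  by apply: contra n3 => /eqP <-.
- move=> q pq qc; have oq := dvdn_odd qc oc.
  have qN := hcN q pq qc.
  have qn : ~~ (q %| n)%N by apply: contra qN; apply: dvdn_mull.
  rewrite mul1r; apply: leg_eq1_dvd => //; rewrite -mulN1r legM // leg_N1_qchar // /N PoszM legM //.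
  rewrite (@leg_sqfree q n) // leg_2_qchar //; apply: (etrans _ (hq q pq qc)).
  have := qchar4_sqr q; rewrite !(modn8_4 n); case: (odd_mod8 on) => -> /=.
  + by move=> _; ring.
  + by move=> k; rewrite mul1r -[in RHS](mul1r (qchar 8 q)) -k; ring.
  + by move=> _; ring.
  + by move=> k; rewrite mul1r -[in RHS](mul1r (qchar 8 q)) -k; ring.
have := @in_class_of_gram 3 (3 * N%:Z) De (3 * t) bb a c%:Z isT isT _ De0 a0 _ e2 _.
have c0 : 0 < c%:Z by case: sc.
rewrite /N PoszM => H; apply: ternary_class (H c0 _ _); first by left.
- by rewrite -mulrA -PoszM e1; ring.
right; rewrite legM // leg_2_3; suff -> : legendre 3 De = 1 by [].
rewrite -(leg1 3); apply: leg_mod => //.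
apply/dvdzP; exists (c%:Z * t ^+ 2 - (N %/ 3)%N%:Z * De).
have : N%:Z = (N %/ 3)%N%:Z * 3 + 1 by rewrite /N; lia.
move: e1; move: (N%:Z) ((N %/ 3)%N%:Z) => N' k + e; rewrite e => e1; lia.
Qed.

Lemma leg_N10 p : prime p -> odd p -> p != 5%N ->
  legendre p (- 10) = qchar 4 p * qchar 8 p * legendre 5 p.
Proof.
move=> pp op p5; have -> : legendre p (- 10) = legendre p (-1) * legendre p 2 * legendre p 5.
  by rewrite -!legM.
by rewrite leg_N1_qchar // leg_2_qchar // leg_5.
Qed.

(** The second diagonal entry is 2 c, so -10 c must be a square modulo the primes of n. As n = 3 mod
    4, the sign in (n/q) cancels (-1/q) in the product character (-5n/q). *)
Lemma repr_115_sqfree (n : nat) : sqfree n -> (n %% 8 = 7)%N -> legendre 5 n = 1 ->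
  exists x y z : int, n = x ^+ 2 + y ^+ 2 + 5 * z ^+ 2 :> int.
Proof.
move=> sn n8 l5n.
have on : odd n by rewrite (divn_eq n 8) n8 oddD oddM andbF.
have n5 : ~~ (5 %| n)%N.
  by have := @leg_eq0 5 n isT isT; rewrite l5n dvdzE => <-.
(* (c/5) = -1 fixes the class; it is compatible because the (-10/p) multiply to (-1/n)(2/n)(n/5) =
   -1. *)
pose e p := if p == 5%N then -1 else legendre p (- 10).
have np p : p \in primes n -> p != 5%N.
  by move=> /(mem_primes_odd on) /and3P[_ _ pn]; apply: contraNneq n5 => <-.
have pn10 p : p \in primes n -> ~~ (p %| 10)%N.
  move=> pin; have /and3P[pp op pn] := mem_primes_odd on pin.
  rewrite (_ : 10 = 2 * 5)%N // Euclid_dvdM // !dvdn_prime2 // negb_or np // andbT.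
  by apply: contraTneq op => ->.
have [|||||c [sc oc pc [k4 k8 ec] hq]] := @exists_prescribed_symbols (5%N :: primes n) false false 1
   1 e (odd_primes_cons (isT : prime 5) isT on n5).
- by [].
- by left.
- by left.
- move=> p; rewrite inE /e; case: eqP => [_ _|p5 /= pin]; first by right.
  have /and3P[pp op pn] := mem_primes_odd on pin.
  by apply: leg_pm1 => //; rewrite dvdzE /= pn10.
- rewrite big_cons {1}/e eqxx (eq_big_seq (fun p => qchar 4 p * qchar 8 p * legendre 5 p)); last first.
    move=> p pin; have /and3P[pp op pn] := mem_primes_odd on pin.
    by rewrite /e (negbTE (np p pin)) leg_N10 // np.
  have ol : {in primes n, forall p, odd p} by move=> p /(mem_primes_odd on) /and3P[].
  rewrite !big_split /= -leg_sqfree_prod // l5n -(qchar8_prod ol) -(proj2 (qchar4_prod ol)).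
  by rewrite -(sqfree_prod_primes sn) /qchar /= modn8_4 n8.
have c5 : ~~ (5 %| c)%N by apply: pc; rewrite inE eqxx.
have s2c : sqfree (2 * c).
  have [c0 sq] := sc; split; first by rewrite muln_gt0.
  move=> q pq; have [->|q2] := eqVneq q 2%N; first by rewrite dvdn_pmul2l // dvdn2 negbK.
  have c2 : coprime q 2 by rewrite prime_coprime // dvdn_prime2.
  by rewrite Gauss_dvdr ?sq // coprimeMl c2.
have hpc p : prime p -> (p %| n)%N -> ~~ (p %| 1 * (2 * c)%N%:Z)%Z.
  move=> pp pn; have pin : p \in primes n by rewrite mem_primes pp pn (proj1 sn).
  rewrite mul1r dvdzE /= Euclid_dvdM // negb_or pc ?inE ?pin ?orbT // andbT.
  by apply: contra (pn10 p pin) => p2; apply: (dvdn_trans p2).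
have hcN q : prime q -> (q %| 2 * c)%N -> ~~ (q %| n)%N.
  move=> pq qc; apply/negP => qN; have := hpc q pq qN; by rewrite mul1r dvdzE /= qc.
have [||De [t [bb [a [De0 a0 e1 e2]]]]] := @gram_congruences n (2 * c)%N 1 5 isT isT sn s2c hpc hcN.
- move=> p pp pn.
  have pin : p \in primes n by rewrite mem_primes pp pn (proj1 sn).
  have /and3P[_ op _] := mem_primes_odd on pin.
  apply: leg_eq1_dvd => //.
  have -> : - (1 * 5 * (2 * c)%N%:Z) = - 10 * c%:Z by rewrite PoszM; ring.
  rewrite legM // ec ?inE ?pin ?orbT // /e (negbTE (np p pin)).
  by apply: leg_sgn => //; rewrite dvdzE /= pn10.
- move=> q pq; rewrite Euclid_dvdM // => /orP[|qc].
    rewrite dvdn_prime2 // => /eqP ->; exists 1; rewrite dvdzE /=.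
    by rewrite -[X in (2 %| X)%N]/(1 + 5 * n)%N dvdn2 oddD oddM on.
  have oq := dvdn_odd qc oc.
  have q5 : q != 5%N by apply: contraNneq c5 => <-.
  have qn : ~~ (q %| n)%N by apply: hcN => //; apply: dvdn_mull.
  apply: leg_eq1_dvd => //; rewrite -mulN1r !legM // leg_N1_qchar // leg_5 //.
  rewrite (@leg_sqfree q n) // modn8_4 n8 /=; apply: (etrans _ (hq q pq qc)); rewrite big_cons.
  have := qchar4_sqr q; move: (qchar 4 q) => k kk.
  transitivity (k * k * (legendre 5 q * \prod_(p <- primes n) legendre p q)); first by ring.
  by rewrite kk !mul1r.
apply: (@ternary_class 5 n%:Z) (@in_class_of_gram 5 n%:Z De t bb a (2 * c)%N%:Z
  isT isT _ De0 a0 _ e2 _); first by right.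
- by case: s2c => c0 _; lia.
- by rewrite e1 mul1r.
left; rewrite PoszM !legM // leg_2_5 ec ?inE ?eqxx // /e eqxx.
by rewrite l5n.
Qed.

Lemma sqfree_decomp n : (0 < n)%N -> exists m k, [/\ sqfree m, (0 < k)%N & n = (m * k ^ 2)%N].
Proof.
elim/ltn_ind: n => n IH n0.
have [/hasP[q _ /andP[pq /dvdnP[l e]]]|/hasPn h] :=
  boolP (has (fun q => prime q && (q * q %| n)%N) (iota 0 n.+1)).
  have l0 : (0 < l)%N by move: n0; rewrite e muln_gt0 => /andP[].
  have [|//|m [k [sm k0 em]]] := IH l.
    by rewrite e ltn_Pmulr // (@ltn_mul 1 1) ?prime_gt1.
  exists m, (k * q)%N; split=> //; first by rewrite muln_gt0 k0 prime_gt0.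
  by rewrite e em; ring.
exists n, 1%N; rewrite exp1n muln1; split=> //; split=> // q pq.
apply/negP => qn; have : (q <= n)%N.
  by apply: leq_trans (dvdn_leq n0 qn); rewrite leq_pmulr // prime_gt0.
by move=> qle; have := h q; rewrite mem_iota ltnS qle pq qn => /(_ isT).
Qed.

Lemma repr_113 (n : nat) : ~~ (3 %| n)%N ->
  exists x y z : int, n = x ^+ 2 + y ^+ 2 + 3 * z ^+ 2 :> int.
Proof.
move=> n3; have n0 : (0 < n)%N by case: n n3.
have [m [k [sm k0 e]]] := sqfree_decomp n0.
have m3 : ~~ (3 %| m)%N by apply: contra n3; rewrite e; apply: dvdn_mulr.
suff [x [y [z h]]] : exists x y z : int, m = x ^+ 2 + y ^+ 2 + 3 * z ^+ 2 :> int.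
  exists (x * k%:Z), (y * k%:Z), (z * k%:Z); rewrite e PoszM h; ring.
have [om|em] := boolP (odd m).
  by have := @repr_113_sqfree m false om; rewrite expn0 mul1n; apply.
have [h eh] : exists h, m = (2 ^ true * h)%N.
  by exists m./2; rewrite expn1 mul2n -[LHS](odd_double_half m) (negbTE em).
rewrite {}eh in sm m3 *; apply: repr_113_sqfree => //.
  apply: contraT => eh; have [_ /(_ 2%N isT)/negP[]] := sm.
  by rewrite expn1 dvdn_pmul2l // dvdn2.
by apply: contra m3; apply: dvdn_mull.
Qed.

Lemma odd_sqr_mod8 k : odd k -> (k ^ 2 %% 8 = 1)%N.
Proof. by move=> ok; rewrite -modnXm; case: (odd_mod8 ok) => ->. Qed.

(** Since -1 is not a square modulo 3, 6 m = x^2 + y^2 + 3 z^2 forces 3 to divide x and y; dividing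
    by 3 gives the stated form. *)
Lemma repr_133 (n : nat) : (n %% 6 = 5)%N ->
  exists x y z : int, 2 * n%:Z = 3 * x ^+ 2 + 3 * y ^+ 2 + z ^+ 2.
Proof.
move=> n6; have n0 : (0 < n)%N by lia.
have [m [k [sm k0 e]]] := sqfree_decomp n0.
have on : odd n by rewrite (divn_eq n 6) n6 oddD oddM andbF.
have om : odd m by move: on; rewrite e oddM => /andP[].
have k3 : (k ^ 2 %% 3 = 1)%N.
  have n3 : (n %% 3 = 2)%N by lia.
  rewrite -modnXm; have := @ltn_pmod k 3 isT; case E: (k %% 3)%N => [|[|[|]]] // _.
  by move: n3; rewrite e -modnMmr -modnXm E muln0.
have m3 : (m %% 3 = 2)%N.
  have : (n %% 3 = 2)%N by lia.
  by rewrite e -modnMmr k3 muln1.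
have [x [y [z h]]] := repr_133_sqfree om sm m3.
have [x3 [y3 [ex ey]]] : exists x' y' : int, x = 3 * x' /\ y = 3 * y'.
  have sq (u : int) : (exists u', u = 3 * u') \/ exists v, u ^+ 2 = 3 * v + 1.
    have [[v ->]|[[v ->]|[v ->]]] : (exists v, u = 3 * v) \/ (exists v, u = 3 * v + 1) \/
        exists v, u = 3 * v + 2.
    - have := divz_eq u 3; have := ltz_pmod u (isT : 0 < (3 : int)).
      have := modz_ge0 u (isT : (3 : int) != 0).
      move: (u %/ 3)%Z (u %% 3)%Z => v r h1 h2 ->.
      have [->|[->|->]] : r = 0 \/ r = 1 \/ r = 2 by lia.
      + by left; exists v; ring.
      + by right; left; exists v; ring.
      + by right; right; exists v; ring.
    - by left; exists v.
    - by right; exists (3 * v ^+ 2 + 2 * v); ring.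
    - by right; exists (3 * v ^+ 2 + 4 * v + 1); ring.
  by case: (sq x) => [[x' ex]|[x' ex]]; case: (sq y) => [[y' ey]|[y' ey]];
    [exists x', y'| exfalso; rewrite ex in h; lia|exfalso; rewrite ey in h; lia|exfalso; lia].
exists (x3 * k%:Z), (y3 * k%:Z), (z * k%:Z).
have -> : 2 * n%:Z = (2 * m%:Z) * k%:Z ^+ 2 by rewrite e PoszM; ring.
have -> : 2 * m%:Z = 3 * x3 ^+ 2 + 3 * y3 ^+ 2 + z ^+ 2.
  by apply: (@mulfI _ (3 : int)) => //; rewrite h ex ey; ring.
by ring.
Qed.

Lemma repr_115 (n : nat) : (n %% 8 = 7)%N -> (n %% 5 = 1)%N \/ (n %% 5 = 4)%N ->
  exists x y z : int, n = x ^+ 2 + y ^+ 2 + 5 * z ^+ 2 :> int.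
Proof.
move=> n8 n5; have n0 : (0 < n)%N by lia.
have [m [k [sm k0 e]]] := sqfree_decomp n0.
have on : odd n by rewrite (divn_eq n 8) n8 oddD oddM andbF.
have ok : odd k by move: on; rewrite e oddM oddX => /andP[].
have m8 : (m %% 8 = 7)%N by move: n8; rewrite e -modnMmr (odd_sqr_mod8 ok) muln1.
have l5 (u v : nat) : (u %% 5 = v %% 5)%N -> legendre 5 u = legendre 5 v.
  by move=> uv; apply: leg_mod => //; rewrite -eqz_mod_dvd !modz_nat uv.
have ln : legendre 5 n = 1.
  case: n5 => n5; first by rewrite (l5 n 1%N) // leg1.
  by rewrite (l5 n 4%N) // (legM 2 2) // leg_2_5.
have k5 : ~~ (5 %| k%:Z)%Z.
  rewrite dvdzE; apply/negP => k5.
  have : (5 %| n)%N by rewrite e dvdn_mull // dvdn_exp.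
  by rewrite /dvdn; case: n5 => ->.
have lm : legendre 5 m = 1.
  move: ln; rewrite e PoszM legM // (_ : (k ^ 2)%N%:Z = k%:Z * k%:Z) ?leg_sqr ?mulr1 //.
have [x [y [z h]]] := repr_115_sqfree sm m8 lm.
exists (x * k%:Z), (y * k%:Z), (z * k%:Z); rewrite e PoszM h; ring.
Qed.

(** * The six tuples *)

Lemma div_rem (x : int) (m : nat) : (0 < m)%N ->
  exists (q : int) (r : nat), (r < m)%N /\ x = m%:Z * q + r%:Z.
Proof.
move=> m0; exists (x %/ m)%Z, `|(x %% m)%Z|%N.
have := ltz_pmod x (m0 : 0 < m%:Z); have := modz_ge0 x (lt0r_neq0 (m0 : 0 < m%:Z)).
have := divz_eq x m; move: (_ %/ _)%Z (_ %% _)%Z => q r -> h1 h2; split; first by lia.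
by rewrite gez0_abs // mulrC.
Qed.

(** Up to sign an odd x is 4 k + 1, and only x^2 matters. The second witness supplies x^2 = 1 mod 8
    to linear arithmetic. The case lemmas below work alike. *)
Lemma even_or_odd (x : int) :
  (exists k, x = 2 * k) \/ exists k j, x ^+ 2 = (4 * k + 1) ^+ 2 /\ x ^+ 2 = 8 * j + 1.
Proof.
have [q [r [hr ->]]] := div_rem x (isT : (0 < 4)%N); case: r hr => [|[|[|[|//]]]] _.
- by left; exists (2 * q); ring.
- by right; exists q, (2 * q ^+ 2 + q); split; ring.
- by left; exists (2 * q + 1); ring.
- by right; exists (- q - 1), (2 * q ^+ 2 + 3 * q + 1); split; ring.
Qed.

Lemma mod3_cases (x : int) :
  (exists k, x = 3 * k) \/ exists k j, x ^+ 2 = (3 * k + 1) ^+ 2 /\ x ^+ 2 = 3 * j + 1.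
Proof.
have [q [r [hr ->]]] := div_rem x (isT : (0 < 3)%N); case: r hr => [|[|[|//]]] _.
- by left; exists q; ring.
- by right; exists q, (3 * q ^+ 2 + 2 * q); split; ring.
- by right; exists (- q - 1), (3 * q ^+ 2 + 4 * q + 1); split; ring.
Qed.

Lemma mod6_cases (x k j : int) : x ^+ 2 = 8 * k + 1 -> x ^+ 2 = 3 * j + 1 ->
  exists y, x ^+ 2 = (6 * y + 1) ^+ 2.
Proof.
have [q [r [hr ->]]] := div_rem x (isT : (0 < 6)%N); case: r hr => [|[|[|[|[|[|//]]]]]] _ h1 h2.
- by exfalso; lia.
- by exists q; ring.
- by exfalso; lia.
- by exfalso; lia.
- by exfalso; lia.
- by exists (- q - 1); ring.
Qed.

Lemma mod5_cases (x : int) : [\/ exists k, x = 5 * k,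
  exists j, x ^+ 2 = 5 * j + 1 | exists j, x ^+ 2 = 5 * j + 4].
Proof.
have [q [r [hr ->]]] := div_rem x (isT : (0 < 5)%N); case: r hr => [|[|[|[|[|//]]]]] _.
- by constructor 1; exists q; ring.
- by constructor 2; exists (5 * q ^+ 2 + 2 * q); ring.
- by constructor 3; exists (5 * q ^+ 2 + 4 * q); ring.
- by constructor 3; exists (5 * q ^+ 2 + 6 * q + 1); ring.
- by constructor 2; exists (5 * q ^+ 2 + 8 * q + 3); ring.
Qed.

Lemma mod10_cases (x k : int) : x ^+ 2 = 8 * k + 1 ->
  ((exists j, x ^+ 2 = 5 * j + 1) -> exists y, x ^+ 2 = (10 * y + 1) ^+ 2) /\
  ((exists j, x ^+ 2 = 5 * j + 4) -> exists y, x ^+ 2 = (10 * y + 3) ^+ 2).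
Proof.
have [q [r [hr ->]]] := div_rem x (isT : (0 < 10)%N); case: r hr => [|[|[|[|[|[|[|[|[|[|//]]]]]]]]]] _ h;
  try (exfalso; lia); split=> -[j hj]; try (exfalso; lia).
- by exists q; ring.
- by exists q; ring.
- by exists (- q - 1); ring.
- by exists (- q - 1); ring.
Qed.

Lemma universal_intro (a1 a2 b1 b2 c1 c2 : int) :
  0 < a1 -> 0 < b1 -> 0 < c1 ->
  (2 %| a1 - a2)%Z -> (2 %| b1 - b2)%Z -> (2 %| c1 - c2)%Z ->
  (forall n : nat, exists x y z : int,
     2 * n%:Z = x * (a1 * x + a2) + y * (b1 * y + b2) + z * (c1 * z + c2)) ->
  universal a1 a2 b1 b2 c1 c2.
Proof.
move=> ? ? ? ? ? ? h; split=> // n; have [x [y [z e]]] := h n; exists x, y, z.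
rewrite /half_quad -!mulrDl -!rmorphD /= -e rmorphM /=.
by rewrite mulrC mulKf // pmulrn.
Qed.

(** In 12 n + 10 = x^2 + y^2 + 3 z^2, z is even modulo 4, so x and y have equal parity; put x = q +
    p, y = q - p and halve. *)
Lemma repr_116 (n : nat) : exists x y z : int,
  6 * n%:Z + 5 = x ^+ 2 + y ^+ 2 + 6 * z ^+ 2.
Proof.
have [|x [y [z h]]] := @repr_113 (12 * n + 10)%N; first by rewrite /dvdn; lia.
have [[t et]|[? [j [_ ej]]]] := even_or_odd z; last first.
  by exfalso; case: (even_or_odd x) => [[x' ex]|[? [x' [_ ex]]]];
     case: (even_or_odd y) => [[y' ey]|[? [y' [_ ey]]]]; rewrite ?ex ?ey ej in h; lia.
have [q [p [ex ey]]] : exists q p : int, x = q + p /\ y = q - p.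
  have [xq [xr [hxr ex]]] := div_rem x (isT : (0 < 2)%N).
  have [yq [yr [hyr ey]]] := div_rem y (isT : (0 < 2)%N).
  case: xr hxr ex => [|[|//]] _ ex; case: yr hyr ey => [|[|//]] _ ey.
  - by exists (xq + yq), (xq - yq); split; lia.
  - by exfalso; rewrite ex ey et in h; lia.
  - by exfalso; rewrite ex ey et in h; lia.
  - by exists (xq + yq + 1), (xq - yq); split; lia.
exists q, p, t; rewrite ex ey et in h; lia.
Qed.

(** Multiplied by 3, the equation is 6 n + 5 = 3 (4x+1)^2 + 2 (3y+1)^2 + 12 z^2. Halving a
    representation of 12 n + 10 gives 3 q^2 + 3 p^2 + 2 v^2, where exactly one of p, q is even. *)
Lemma universal_16_8_6_4_4_0 : universal 16 8 6 4 4 0.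
Proof.
apply: universal_intro => // n.
suff [u [v [z [k [eu [m [ev h]]]]]]] : exists u v z k : int, u ^+ 2 = (4 * k + 1) ^+ 2 /\
    exists m, v ^+ 2 = (3 * m + 1) ^+ 2 /\ 6 * n%:Z + 5 = 3 * u ^+ 2 + 2 * v ^+ 2 + 12 * z ^+ 2.
  by exists k, m, z; rewrite eu ev in h; lia.
have [|x [y [w h]]] := @repr_133 (6 * n + 5)%N; first by lia.
have [[v ev]|[? [w' [_ ew]]]] := even_or_odd w; last first.
  by exfalso; case: (even_or_odd x) => [[x' ex]|[? [x' [_ ex]]]];
     case: (even_or_odd y) => [[y' ey]|[? [y' [_ ey]]]]; rewrite ?ex ?ey ew in h; lia.
have [q [p [ex ey]]] : exists q p : int, x = q + p /\ y = q - p.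
  have [xq [xr [hxr ex]]] := div_rem x (isT : (0 < 2)%N).
  have [yq [yr [hyr ey]]] := div_rem y (isT : (0 < 2)%N).
  case: xr hxr ex => [|[|//]] _ ex; case: yr hyr ey => [|[|//]] _ ey.
  - by exists (xq + yq), (xq - yq); split; lia.
  - by exfalso; rewrite ex ey ev in h; lia.
  - by exfalso; rewrite ex ey ev in h; lia.
  - by exists (xq + yq + 1), (xq - yq); split; lia.
have {}h : 6 * n%:Z + 5 = 3 * q ^+ 2 + 3 * p ^+ 2 + 2 * v ^+ 2 by rewrite ex ey ev in h; lia.
have [[v' ev']|[m [? [em _]]]] := mod3_cases v; first by exfalso; rewrite ev' in h; lia.
have [[q' eq]|[kq [jq [eq jq2]]]] := even_or_odd q; have [[p' ep]|[kp [jp [ep jp2]]]] := even_or_odd p.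
- by exfalso; rewrite eq ep in h; lia.
- by exists p, v, q', kp; split=> //; exists m; split=> //; rewrite h eq; ring.
- by exists q, v, p', kq; split=> //; exists m; split=> //; rewrite h ep; ring.
- by exfalso; rewrite jq2 jp2 in h; lia.
Qed.

(** Multiplied by 6, the equation is 12 n + 11 = 6 (4x+1)^2 + 4 (3y+1)^2 + (6z+1)^2; in x^2 + y^2 +
    6 w^2 exactly one of x, y is even. *)
Lemma universal_16_8_6_4_6_2 : universal 16 8 6 4 6 2.
Proof.
apply: universal_intro => // n.
have [x [y [w h]]] := repr_116 (2 * n + 1).
suff [u [v H]] : exists u v : int, 12 * n%:Z + 11 = u ^+ 2 + 4 * v ^+ 2 + 6 * w ^+ 2.
  have [[w' ew]|[k [w' [ew ew']]]] := even_or_odd w.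
    by exfalso; case: (even_or_odd u) => [[u' eu]|[? [u' [_ eu]]]]; rewrite eu ew in H; lia.
  have [[u' eu]|[? [iu [_ eu]]]] := even_or_odd u; first by exfalso; rewrite eu ew' in H; lia.
  have [[v' ev]|[m [jv [ev ev']]]] := mod3_cases v; have [[u' eu']|[? [ju [_ eu']]]] := mod3_cases u.
  - by exfalso; rewrite eu' ev in H; lia.
  - by exfalso; rewrite eu' ev in H; lia.
  - by exfalso; rewrite eu' ev' in H; lia.
  have [z ez] := mod6_cases eu eu'.
  by exists k, m, z; rewrite ez ev ew in H; lia.
have [[x' ex]|[? [jx [_ ex]]]] := even_or_odd x; have [[y' ey]|[? [jy [_ ey]]]] := even_or_odd y.
- by exfalso; rewrite ex ey in h; lia.
- by exists y, x'; rewrite ex in h; lia.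
- by exists x, y'; rewrite ey in h; lia.
- by exfalso; case: (even_or_odd w) => [[w' ew]|[? [w' [_ ew]]]]; rewrite ex ey ew in h; lia.
Qed.

(** Multiplied by 6, the equation is 12 n + 10 = 9 (4x+1)^2 + (6y+1)^2 + 12 z^2. Doubling p^2 + q^2
    + 6 t^2 gives squares of p + q and p - q, exactly one of them divisible by 3. *)
Lemma universal_24_12_6_2_2_0 : universal 24 12 6 2 2 0.
Proof.
apply: universal_intro => // n.
have [p [q [t h]]] := repr_116 n.
suff [u [v H]] : exists u v : int, 12 * n%:Z + 10 = v ^+ 2 + 9 * u ^+ 2 + 12 * t ^+ 2.
  have [[u' eu]|[k [iu [eu eu']]]] := even_or_odd u.
    by exfalso; case: (even_or_odd v) => [[v' ev]|[? [v' [_ ev]]]]; rewrite eu ev in H; lia.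
  have [[v' ev]|[? [iv [_ ev]]]] := even_or_odd v; first by exfalso; rewrite eu' ev in H; lia.
  have [[v' ev']|[? [jv [_ ev']]]] := mod3_cases v; first by exfalso; rewrite ev' in H; lia.
  have [y ey] := mod6_cases ev ev'.
  by exists k, y, t; rewrite ey eu in H; lia.
have {}h : 12 * n%:Z + 10 = (p + q) ^+ 2 + (p - q) ^+ 2 + 12 * t ^+ 2 by lia.
have [[u eu]|[? [ju [_ eu]]]] := mod3_cases (p + q); have [[v ev]|[? [jv [_ ev]]]] := mod3_cases (p - q).
- by exfalso; rewrite eu ev in h; lia.
- by exists u, (p - q); rewrite h eu; ring.
- by exists v, (p + q); rewrite h ev; ring.
- by exfalso; rewrite eu ev in h; lia.
Qed.

(** Two squares prime to 5 never sum to 1 or 4 modulo 5, so 5 divides x or y; n = 7 mod 8 then makes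
    all three variables odd. Multiplied by 20, both tuples beginning with 20 take this shape. *)
Lemma repr_115_split (n : nat) (r : nat) : (n %% 8 = 7)%N -> (n %% 5 = r)%N -> r = 1%N \/ r = 4%N ->
  exists k v w j : int, [/\ n%:Z = 25 * (4 * k + 1) ^+ 2 + v ^+ 2 + 5 * (4 * w + 1) ^+ 2,
    v ^+ 2 = 8 * j + 1 & exists i, v ^+ 2 = 5 * i + r%:Z].
Proof.
move=> n8 n5 hr.
have [|x [y [z h]]] := @repr_115 n n8; first by rewrite n5; lia.
have en8 : n%:Z = 8 * (n %/ 8)%N%:Z + 7 by lia.
have en5 : n%:Z = 5 * (n %/ 5)%N%:Z + r%:Z by lia.
suff [u [v H]] : exists u v : int, n%:Z = 25 * u ^+ 2 + v ^+ 2 + 5 * z ^+ 2.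
  have [[u' eu]|[k [iu [eu eu']]]] := even_or_odd u.
    by exfalso; case: (even_or_odd v) => [[v' ev]|[? [v' [_ ev]]]];
      case: (even_or_odd z) => [[z' ez]|[? [z' [_ ez]]]]; rewrite en8 eu ev ez in H; lia.
  have [[v' ev]|[? [iv [_ ev]]]] := even_or_odd v.
    by exfalso; case: (even_or_odd z) => [[z' ez]|[? [z' [_ ez]]]]; rewrite en8 eu' ev ez in H; lia.
  have [[w' ew]|[w [iw [ew _]]]] := even_or_odd z; first by exfalso; rewrite en8 eu' ev ew in H; lia.
  exists k, v, w, iv; split=> //; first by rewrite H eu ew.
  exists ((n %/ 5)%N%:Z - 5 * u ^+ 2 - z ^+ 2).
  have -> : v ^+ 2 = n%:Z - 25 * u ^+ 2 - 5 * z ^+ 2 by rewrite H; ring.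
  by rewrite {1}en5; ring.
case: (mod5_cases x) (mod5_cases y) => [[x' ex]|[jx ex]|[jx ex]] [[y' ey]|[jy ey]|[jy ey]].
- by exists x', y; rewrite h ex; ring.
- by exists x', y; rewrite h ex; ring.
- by exists x', y; rewrite h ex; ring.
- by exists y', x; rewrite h ey; ring.
- by exfalso; rewrite en5 ex ey in h; lia.
- by exfalso; rewrite en5 ex ey in h; lia.
- by exists y', x; rewrite h ey; ring.
- by exfalso; rewrite en5 ex ey in h; lia.
- by exfalso; rewrite en5 ex ey in h; lia.
Qed.

Lemma universal_20_10_5_1_4_2 : universal 20 10 5 1 4 2.
Proof.
apply: universal_intro => // n.
have [|||k [v [w [j [h e8 e5]]]]] := @repr_115_split (40 * n + 31)%N 1; [lia|lia|by left|].
have [/(_ e5) [y ey] _] := mod10_cases e8.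
by exists k, y, w; rewrite ey in h; lia.
Qed.

Lemma universal_20_10_5_3_4_2 : universal 20 10 5 3 4 2.
Proof.
apply: universal_intro => // n.
have [|||k [v [w [j [h e8 e5]]]]] := @repr_115_split (40 * n + 39)%N 4; [lia|lia|by right|].
have [_ /(_ e5) [y ey]] := mod10_cases e8.
by exists k, y, w; rewrite ey in h; lia.
Qed.

Lemma parity (x : int) : exists k, x = 2 * k \/ x = 2 * k + 1.
Proof.
have [q [r [hr ->]]] := div_rem x (isT : (0 < 2)%N).
by case: r hr => [|[|//]] _; exists q; [left|right]; ring.
Qed.

(* If x, y, z are all odd, a rotation of x^2 + 3z^2 makes x and z even.  If they are
   all even, divide by 4 and use 4(q^2 + 3u^2) = (q + 3u)^2 + 3(q - u)^2. *)
Lemma repr_113_mixed (n : nat) : exists p q u k : int,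
  3 * n%:Z + 2 = p ^+ 2 + q ^+ 2 + 3 * u ^+ 2 /\ q = u + 2 * k + 1.
Proof.
elim/ltn_ind: n => n IH.
have [|x [y [z h]]] := @repr_113 (3 * n + 2)%N; first by rewrite /dvdn; lia.
have {}h : 3 * n%:Z + 2 = x ^+ 2 + y ^+ 2 + 3 * z ^+ 2 by rewrite -h; lia.
have [x' ex] := parity x; have [y' ey] := parity y; have [z' ez] := parity z.
have [yz|yz] : (exists k, y = z + 2 * k + 1) \/ exists k, y = z + 2 * k.
- case: ey => ->; case: ez => ->; [right|left|left|right];
   [exists (y' - z')|exists (y' - z' - 1)|exists (y' - z')|exists (y' - z')]; ring.
- by case: yz => k ek; exists x, y, z, k.
have [xz|xz] : (exists k, x = z + 2 * k + 1) \/ exists k, x = z + 2 * k.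
- case: ex => ->; case: ez => ->; [right|left|left|right];
   [exists (x' - z')|exists (x' - z' - 1)|exists (x' - z')|exists (x' - z')]; ring.
- by case: xz => k ek; exists y, x, z, k; split=> //; rewrite h; ring.
case: ez => ez.
  have [k ek] := yz; have [l el] := xz.
  have en : 3 * n%:Z + 2 = 4 * ((z' + l) ^+ 2 + (z' + k) ^+ 2 + 3 * z' ^+ 2).
    by rewrite h ek el ez; ring.
  have [m em] : exists m, n = (4 * m + 2)%N.
    exists (n %/ 4)%N; move: en; move: (_ + 3 * _) => s en; lia.
  have [|p [q [u [j [hj ej]]]]] := IH m; first by lia.
  exists (q + 3 * u), (2 * p), (q - u), (p - j - 1); split; last by rewrite ej; ring.
  have -> : 3 * n%:Z + 2 = 4 * (3 * m%:Z + 2) by rewrite em; lia.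
  by rewrite hj; ring.
(* All three are odd here. The parity of l selects the rotation whose new last variable, l or z + l,
   is even, while y stays odd. *)
have [k ek] := yz; have [l el] := xz; have [m [em|em]] := parity l.
  exists (2 * z + l), y, l, (z' + k - m); split; first by rewrite h el; ring.
  by rewrite ek em ez; ring.
exists (l - z), y, (z + l), (k - m - 1); split; first by rewrite h el; ring.
by rewrite ek em ez; ring.
Qed.

(* 4(q^2 + 3u^2) equals both (q + 3u)^2 + 3(q - u)^2 and (q - 3u)^2 + 3(q + u)^2. *)
Lemma repr_143 (n : nat) : exists v w u k : int,
  [/\ 12 * n%:Z + 8 = 4 * v ^+ 2 + w ^+ 2 + 3 * u ^+ 2, u = 2 * k + 1 &
      exists j, u ^+ 2 = 3 * j + 1].
Proof.
have [p [q [u [k [h ek]]]]] := repr_113_mixed n.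
have e4 : 12 * n%:Z + 8 = 4 * (p ^+ 2 + q ^+ 2 + 3 * u ^+ 2) by rewrite -h; ring.
have [[s es]|[? [j [_ ej]]]] := mod3_cases (q - u); last first.
  by exists p, (q + 3 * u), (q - u), k; split; [rewrite e4; ring|rewrite ek; ring|exists j].
have [[t et]|[? [j [_ ej]]]] := mod3_cases (q + u); last first.
  by exists p, (q - 3 * u), (q + u), (u + k); split; [rewrite e4; ring|rewrite ek; ring|exists j].
(* Otherwise 3 divides both q and u, and p^2 = 2 modulo 3. *)
exfalso.
have [v ev] : exists v, q = 3 * v by exists (2 * (s + t) - q); lia.
have [w ew] : exists w, u = 3 * w by exists (2 * (t - s) - u); lia.
have [[p' ep]|[? [p' [_ ep]]]] := mod3_cases p; rewrite ep ev ew in h; lia.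
Qed.

(** Multiplied by 6, the equation is 12 n + 8 = 3 (6x+1)^2 + 4 (3y+1)^2 + (6z+1)^2. Only u needs the
    preceding lemmas: congruences make w odd, and v and w prime to 3. *)
Lemma universal_18_6_6_4_6_2 : universal 18 6 6 4 6 2.
Proof.
apply: universal_intro => // n.
have [v [w [u [k [h eu [j ej]]]]]] := repr_143 n.
have [w' ew] := parity w.
have [[u' eu']|[? [iu [_ eu']]]] := even_or_odd u; first by lia.
have [x ex] := mod6_cases eu' ej.
have [[w2 ew2]|[? [iw [_ ew2]]]] := even_or_odd w; first by exfalso; rewrite ew2 eu' in h; lia.
have [[v3 ev3]|[m [jv [ev ev3]]]] := mod3_cases v; have [[w3 ew3]|[? [jw [_ ew3]]]] := mod3_cases w.
- by exfalso; rewrite ev3 ew3 in h; lia.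
- by exfalso; rewrite ev3 ew3 in h; lia.
- by exfalso; rewrite ev3 ew3 in h; lia.
have [z ez] := mod6_cases ew2 ew3.
by exists x, m, z; rewrite ex ev ez in h; lia.
Qed.

Theorem theorem2p4 :
  universal 16 8 6 4 4 0 /\
  universal 16 8 6 4 6 2 /\
  universal 18 6 6 4 6 2 /\
  universal 20 10 5 1 4 2 /\
  universal 20 10 5 3 4 2 /\
  universal 24 12 6 2 2 0.
Proof.
split; [exact: universal_16_8_6_4_4_0|split; [exact: universal_16_8_6_4_6_2|]].
split; [exact: universal_18_6_6_4_6_2|split; [exact: universal_20_10_5_1_4_2|]].
by split; [exact: universal_20_10_5_3_4_2|exact: universal_24_12_6_2_2_0].
Qed.
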